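(* Let $\mathbb{F}$ be a field, let $P$ be a finite distributive lattice of dimension $n$, with $n\ge 2$, and let $F\colon P\to\mathsf{Vec}_{\mathbb{F}}$ be a finitely generated persistence module. Then the following are equivalent. (1) $F$ has projective dimension at most $n-2$. (2) $F$ is degree $n-1$ and cross-degree $n-2$. (3) $F\cong T^{n-1}\Gamma^{n-2}F$.
   Context: Notation: $[k]=\{0,\dots,k\}$; $\mathcal{P}(S)$ is the power set of $S$ ordered by inclusion. A lattice $P$ is distributive if $x\wedge(y\vee z)=(x\wedge y)\vee(x\wedge z)$ for all $x,y,z$. Posets are viewed as categories. A persistence module is a functor $F\colon P\to\mathsf{Vec}_{\mathbb{F}}$ from a poset $P$ to vector spaces over $\mathbb{F}$. These form the abelian category $\mathrm{Fun}(P,\mathsf{Vec}_{\mathbb{F}})$, which has enough projectives. $F$ is finitely generated if it is a quotient of a finite direct sum of modules $\mathbb{F}[x,-)$, where $\mathbb{F}[x,-)$ is $\mathbb{F}$ on $\{y: y\ge x\}$ (with identity maps) and $0$ elsewhere; for finite $P$ this means that all $F(x)$ are finite-dimensional. An object $A$ has projective dimension at most $m$ if it admits a projective resolution $0\to Q_m\to\dots\to Q_0\to A\to 0$. The dimension (order dimension, Dushnik–Miller dimension) of a poset $P$ is the minimal number of total orders such that $P$ embeds, via an order embedding ($x\le y\iff i(x)\le i(y)$), into their product with the product order. Meet-dimension: $v\in P$ is meet-irreducible if $v\ne x\wedge y$ for all $x,y>v$. Put $\mathrm{mdim}(v)=0$ if $v$ is maximal in $P$; otherwise $\mathrm{mdim}(v)$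 is the least $k$ such that $v$ is a meet of $k$ meet-irreducible elements. $P^{\le k}=\{v\in P:\mathrm{mdim}(v)\le k\}$. $T^kF$ is the right Kan extension of $F|_{P^{\le k}}$ along $P^{\le k}\hookrightarrow P$, i.e. $T^kF(x)=\lim_{v\in P^{\le k},\,v\ge x}F(v)$, with canonical natural transformation $\eta_k\colon F\to T^kF$. Define $\Gamma^kF=\mathrm{im}(\eta_k\colon F\to T^kF)$. A $k$-cube in a category $\mathscr{C}$ is a functor $\mathcal{X}\colon\mathcal{P}([k-1])\to\mathscr{C}$. It is cartesian if the canonical map $\mathcal{X}(\emptyset)\to\lim_{\emptyset\ne S\subseteq[k-1]}\mathcal{X}(S)$ is an isomorphism; cocartesian is the dual notion. A cube is strongly bicartesian if each face of dimension at least 2 is both cartesian and cocartesian; for a cube $\mathcal{X}$ in a lattice this means $\mathcal{X}(S\cup T)=\mathcal{X}(S)\vee\mathcal{X}(T)$ and $\mathcal{X}(S\cap T)=\mathcal{X}(S)\wedge\mathcal{X}(T)$ for all $S,T$. The total fiber of a $1$-cube of vector spaces is $\mathrm{tfib}(\mathcal{X})=\ker(\mathcal{X}(\emptyset)\to\mathcal{X}(\{0\}))$, and for a $k$-cube with $k>1$ it is the kernel of the induced map from the total fiber of the $(k-1)$-cube $S\mapsto\mathcal{X}(S)$ to that of $S\mapsto\mathcal{X}(S\cup\{k-1\})$ ($S\subseteq[k-2]$). $F$ is degree $k$ if $F\circ\mathcal{X}$ is cartesian for every strongly bicartesian $(k+1)$-cube $\mathcal{X}\colon\mathcal{P}([k])\to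 P$. $F$ is cross-degree $k$ if $\mathrm{tfib}(F\circ\mathcal{X})\cong0$ for every such $\mathcal{X}$. *)

(* Defs.v *)
From HB Require Import structures.
From mathcomp Require Import all_boot all_order all_algebra.
From mathcomp Require Import boolp.

Set Implicit Arguments.
Unset Strict Implicit.
Unset Printing Implicit Defensive.

Import Order.TTheory GRing.Theory.
Import Order.DefaultSetSubsetOrder.
Local Open Scope order_scope.

Section DependentProduct.
Variables (K : fieldType) (I : finType) (V : I -> lmodType K).
Local Open Scope ring_scope.

Definition dprod := {dffun forall i, V i}.
HB.instance Definition _ := Choice.on dprod.

Implicit Types f g h : dprod.

Definition dprod_add f g : dprod := [ffun i => f i + g i].
Definition dprod_opp f : dprod := [ffun i => - f i].
Definition dprod_zero : dprod := [ffun i => 0].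
Definition dprod_scale (a : K) f : dprod := [ffun i => a *: f i].

Fact dprod_addA : associative dprod_add.
Proof. by move=> f g h; apply/ffunP=> i; rewrite !ffunE addrA. Qed.
Fact dprod_addC : commutative dprod_add.
Proof. by move=> f g; apply/ffunP=> i; rewrite !ffunE addrC. Qed.
Fact dprod_add0 : left_id dprod_zero dprod_add.
Proof. by move=> f; apply/ffunP=> i; rewrite !ffunE add0r. Qed.
Fact dprod_addN : left_inverse dprod_zero dprod_opp dprod_add.
Proof. by move=> f; apply/ffunP=> i; rewrite !ffunE addNr. Qed.

HB.instance Definition _ := GRing.isZmodule.Build dprod
  dprod_addA dprod_addC dprod_add0 dprod_addN.

Fact dprod_scaleA a b f :
  dprod_scale a (dprod_scale b f) = dprod_scale (a * b) f.
Proof. by apply/ffunP=> i; rewrite !ffunE scalerA. Qed.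
Fact dprod_scale1 : left_id 1 dprod_scale.
Proof. by move=> f; apply/ffunP=> i; rewrite !ffunE scale1r. Qed.
Fact dprod_scaleDr : right_distributive dprod_scale +%R.
Proof. by move=> a f g; apply/ffunP=> i; rewrite !ffunE scalerDr. Qed.
Fact dprod_scaleDl f : {morph dprod_scale^~ f : a b / a + b}.
Proof. by move=> a b; apply/ffunP=> i; rewrite !ffunE scalerDl. Qed.

HB.instance Definition _ := GRing.Zmodule_isLmodule.Build K dprod
  dprod_scaleA dprod_scale1 dprod_scaleDr dprod_scaleDl.

Lemma dprodD f g i : (f + g) i = f i + g i.
Proof. by rewrite ffunE. Qed.
Lemma dprodZ a f i : (a *: f) i = a *: f i.
Proof. by rewrite ffunE. Qed.
Lemma dprod0 i : (0 : dprod) i = 0.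
Proof. by rewrite ffunE. Qed.

End DependentProduct.

Section DependentProductMap.
Variables (K : fieldType) (I : finType) (V W : I -> lmodType K).
Variable f : forall i, {linear V i -> W i}.
Local Open Scope ring_scope.

Definition dprod_map (u : dprod V) : dprod W := [ffun i => f i (u i)].

Fact dprod_map_linear : linear dprod_map.
Proof.
by move=> a u v; apply/ffunP=> i; rewrite !ffunE linearP.
Qed.
HB.instance Definition _ :=
  GRing.isLinear.Build K (dprod V) (dprod W) *:%R dprod_map dprod_map_linear.

End DependentProductMap.

Section Subspaces.
Variable K : fieldType.
Local Open Scope ring_scope.

Section Subspace.
Variables (V : lmodType K) (S : submodClosed V).

Definition subspace := {v : V | v \in S}.
HB.instance Definition _ := SubType.on subspace.
HB.instance Definition _ := Choice.on subspace.
HB.instance Definition _ := [SubChoice_isSubLmodule of subspace by <:].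

End Subspace.

(** A linear map that sends the subspace [S] into the subspace [T],
    corestricted to a map between them. *)
Section SubspaceMap.
Variables (V W : lmodType K) (S : submodClosed V) (T : submodClosed W).
Variables (f : {linear V -> W}) (fST : forall v, v \in S -> f v \in T).

Definition subspace_map (v : subspace S) : subspace T :=
  exist _ (f (val v)) (fST (valP v)).

Fact subspace_map_linear : linear subspace_map.
Proof. by move=> a u v; apply/val_inj; rewrite /= !linearP. Qed.
HB.instance Definition _ :=
  GRing.isLinear.Build K (subspace S) (subspace T) *:%R subspace_map
    subspace_map_linear.

End SubspaceMap.

Section Corestriction.
Variables (V W : lmodType K) (T : submodClosed W).
Variables (f : {linear V -> W}) (fT : forall v, f v \in T).

Definition corestr (v : V) : subspace T := exist _ (f v) (fT v).

Fact corestr_linear : linear corestr.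
Proof. by move=> a u v; apply/val_inj; rewrite /= !linearP. Qed.
HB.instance Definition _ :=
  GRing.isLinear.Build K V (subspace T) *:%R corestr corestr_linear.

End Corestriction.

Section KernelImage.
Variables (V W : lmodType K) (f : {linear V -> W}).

Definition lin_ker : {pred V} := [pred v | f v == 0].
Fact lin_ker_closed : submod_closed lin_ker.
Proof.
split=> [|a u v]; rewrite !inE ?linear0 //.
by move=> /eqP fu0 /eqP fv0; rewrite linearP fu0 fv0 scaler0 addr0.
Qed.
HB.instance Definition _ :=
  GRing.isSubmodClosed.Build K V lin_ker lin_ker_closed.
Definition ker_space : lmodType K := subspace (V := V) lin_ker.

Definition lin_im : {pred W} := [pred w | `[< exists v, f v = w >]].
Fact lin_im_closed : submod_closed lin_im.
Proof.
split=> [|a _ _ /asboolP[u <-] /asboolP[v <-]]; apply/asboolP.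
  by exists 0; rewrite linear0.
by exists (a *: u + v); rewrite linearP.
Qed.
HB.instance Definition _ :=
  GRing.isSubmodClosed.Build K W lin_im lin_im_closed.
Definition im_space : lmodType K := subspace (V := W) lin_im.

End KernelImage.

End Subspaces.

Section PersistenceModules.
Variable K : fieldType.

(** Functors from the poset [P] to vector spaces over [K], of arbitrary
    dimension. *)
Record pmod d (P : porderType d) := PMod {
  pobj :> P -> lmodType K;
  pmor : forall x y : P, x <= y -> {linear pobj x -> pobj y};
  pmor_id : forall x (h : x <= x) v, pmor h v = v;
  pmor_comp : forall x y z (h : x <= y) (h' : y <= z) (h'' : x <= z) v,
    pmor h'' v = pmor h' (pmor h v)
}.

Record phom d (P : porderType d) (F G : pmod P) := PHom {
  pcomp :> forall x, {linear F x -> G x};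
  phom_natural : forall x y (h : x <= y) v,
    pcomp y (pmor F h v) = pmor G h (pcomp x v)
}.

Section Basics.
Variables (d : Order.disp_t) (P : porderType d).
Implicit Types F G : pmod P.

Lemma pmor_square F x y y' z (h : x <= y) (g : y <= z) (h' : x <= y')
    (g' : y' <= z) v :
  pmor F g (pmor F h v) = pmor F g' (pmor F h' v).
Proof.
by rewrite -(pmor_comp h g (le_trans h g)) -(pmor_comp h' g' (le_trans h g)).
Qed.

Definition piso F G : Prop := exists (f : phom F G) (g : phom G F),
  (forall x, cancel (f x) (g x)) /\ (forall x, cancel (g x) (f x)).

(** Epimorphisms and exactness in the functor category are pointwise. *)
Definition pepi F G (f : phom F G) : Prop :=
  forall x (w : G x), exists v, f x v = w.

Definition pexact F G H (f : phom F G) (g : phom G H) : Prop :=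
  forall x (w : G x), g x w = 0%R <-> exists v, f x v = w.

Definition pzero F : Prop := forall x (v : F x), v = 0%R.

Definition projective (Q : pmod P) : Prop :=
  forall F G (p : phom F G) (f : phom Q G), pepi p ->
  exists g : phom Q F, forall x v, p x (g x v) = f x v.

(** A resolution of length at most [m] is indexed by all of [nat], with zero
    terms in degrees greater than [m]. *)
Definition proj_dim_le (F : pmod P) (m : nat) : Prop :=
  exists (Q : nat -> pmod P) (dif : forall i, phom (Q i.+1) (Q i))
         (aug : phom (Q 0) F),
    [/\ (forall i, projective (Q i)),
        (forall i, (m < i)%N -> pzero (Q i)),
        pepi aug,
        pexact (dif 0) aug
      & forall i, pexact (dif i.+1) (dif i)].

End Basics.

(** The module F[x,-). Its value at [y] is written as the space of row vectors
    of length [x <= y], read as 1 or 0; the structure maps multiply by the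
    all-ones matrix, which is the identity when [x <= y]. *)
Section Free.
Variables (d : Order.disp_t) (P : porderType d) (x : P).
Local Open Scope ring_scope.

Definition free_map (y z : P) :
    {linear 'rV[K]_(x <= y)%O -> 'rV[K]_(x <= z)%O} :=
  mulmxr (const_mx 1).

Fact free_id y (h : (y <= y)%O) v : @free_map y y v = v.
Proof.
rewrite /free_map /=; move: v; case: (x <= y)%O => v; last by rewrite !thinmx0.
rewrite (_ : const_mx 1 = 1%:M) ?mulmx1 //.
by apply/matrixP=> i j; rewrite !mxE !ord1.
Qed.

Fact free_comp y z t (h : (y <= z)%O) (h' : (z <= t)%O) (h'' : (y <= t)%O) v :
  @free_map y t v = @free_map z t (@free_map y z v).
Proof.
rewrite /free_map /= -mulmxA; congr (v *m _); move: v.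
case xy: (x <= y)%O => v; last by apply/matrixP=> -[].
have xz : (x <= z)%O by apply: le_trans h.
have xt : (x <= t)%O by apply: le_trans h'.
by rewrite xz xt; apply/matrixP=> i j; rewrite !mxE big_ord1 !mxE mulr1.
Qed.

Definition pfree : pmod P :=
  @PMod _ P (fun y => 'rV[K]_(x <= y)%O) (fun y z _ => free_map y z)
    free_id free_comp.

End Free.

Section DirectSum.
Variables (d : Order.disp_t) (P : porderType d) (I : finType).
Variable Q : I -> pmod P.

Definition psum_map x y (h : x <= y) : {linear dprod (Q^~ x) -> dprod (Q^~ y)} :=
  dprod_map (fun i => pmor (Q i) h).

Fact psum_id x (h : x <= x) v : psum_map h v = v.
Proof. by apply/ffunP=> i; rewrite ffunE pmor_id. Qed.
Fact psum_comp x y z (h : x <= y) (h' : y <= z) (h'' : x <= z) v :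
  psum_map h'' v = psum_map h' (psum_map h v).
Proof. by apply/ffunP=> i; rewrite !ffunE -pmor_comp. Qed.

Definition psum : pmod P :=
  @PMod _ P (fun x => dprod (Q^~ x)) psum_map psum_id psum_comp.

End DirectSum.

Definition finitely_generated d (P : porderType d) (F : pmod P) : Prop :=
  exists (m : nat) (x : 'I_m -> P)
         (p : phom (psum (fun i => pfree (x i))) F), pepi p.

Section Image.
Variables (d : Order.disp_t) (P : porderType d) (F G : pmod P) (f : phom F G).

Fact pimage_stable x y (h : x <= y) w :
  w \in lin_im (f x) -> pmor G h w \in lin_im (f y).
Proof.
move=> /asboolP[v <-]; apply/asboolP.
by exists (pmor F h v); rewrite phom_natural.
Qed.

Definition pimage_map x y (h : x <= y) :
    {linear im_space (f x) -> im_space (f y)} :=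
  subspace_map (pimage_stable h).

Fact pimage_id x (h : x <= x) v : pimage_map h v = v.
Proof. by apply/val_inj; rewrite /= pmor_id. Qed.
Fact pimage_comp x y z (h : x <= y) (h' : y <= z) (h'' : x <= z) v :
  pimage_map h'' v = pimage_map h' (pimage_map h v).
Proof. by apply/val_inj; rewrite /= -pmor_comp. Qed.

Definition pimage : pmod P :=
  @PMod _ P (fun x => im_space (f x)) pimage_map pimage_id pimage_comp.

End Image.

Section Precomposition.
Variables (d d' : Order.disp_t) (Q : porderType d) (P : porderType d').

Definition ppull (F : pmod P) (X : {omorphism Q -> P}) : pmod Q :=
  @PMod _ Q (fun x => F (X x)) (fun x y h => pmor F (omorph_le X h))
    (fun x h => pmor_id (omorph_le X h))
    (fun x y z h h' h'' =>
       pmor_comp (omorph_le X h) (omorph_le X h') (omorph_le X h'')).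

Definition ppull_hom (F G : pmod P) (f : phom F G) (X : {omorphism Q -> P}) :
    phom (ppull F X) (ppull G X) :=
  @PHom _ Q (ppull F X) (ppull G X) (fun x => f (X x))
    (fun x y h => phom_natural f (omorph_le X h)).

End Precomposition.

Section Limits.
Variables (d : Order.disp_t) (P : finPOrderType d) (F : pmod P).
Local Notation idx D := {v : P | D v}.
Local Notation families D := (dprod (fun v : idx D => F (val v))).

Definition compatible (D : pred P) :
    {pred families D} :=
  [pred s : families D | `[< forall (u v : idx D) (h : val u <= val v),
                  pmor F h (s u) = s v >]].

Fact compatible_closed (D : pred P) : submod_closed (compatible (D := D)).
Proof.
split=> [|a s t /asboolP sc /asboolP tc]; apply/asboolP=> u v h.
  by rewrite !dprod0 linear0.
by rewrite !(dprodD, dprodZ) linearP sc tc.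
Qed.
HB.instance Definition _ (D : pred P) :=
  GRing.isSubmodClosed.Build K (families D)
    (compatible (D := D)) (compatible_closed D).

(** The limit of the restriction of [F] to the full subposet of the [v]
    satisfying [D], as the space of compatible families. *)
Definition plim (D : pred P) : lmodType K :=
  subspace (V := families D) (compatible (D := D)).

Lemma family_irrelevance (D : pred P) (s : families D) v (p q : D v) :
  s (exist _ v p) = s (exist _ v q).
Proof. by rewrite (bool_irrelevance p q). Qed.

(** The map [lim_D F -> lim_E F] for [E] contained in [D]. *)
Section Restriction.
Variables (D E : pred P) (ED : forall v, E v -> D v).

Definition sub_idx (v : idx E) : idx D := exist _ (val v) (ED (valP v)).

Definition family_restr (s : families D) :
    families E :=
  [ffun v => s (sub_idx v)].

Fact family_restr_linear : linear family_restr.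
Proof. by move=> a s t; apply/ffunP=> v; rewrite !ffunE. Qed.
HB.instance Definition _ :=
  GRing.isLinear.Build K (families D)
    (families E) *:%R family_restr family_restr_linear.

Fact family_restr_compatible s :
  s \in compatible (D := D) -> family_restr s \in compatible (D := E).
Proof.
move=> /asboolP sc; apply/asboolP=> u v h; rewrite !ffunE /=.
exact: (sc (sub_idx u) (sub_idx v) h).
Qed.

Definition plim_restr : {linear plim D -> plim E} :=
  subspace_map family_restr_compatible.

End Restriction.

(** The canonical map [F x -> lim_D F] for [x] a lower bound of [D]. *)
Section Cone.
Variables (D : pred P) (x : P) (xD : forall v, D v -> x <= v).

Definition cone_family (a : F x) : families D :=
  [ffun v => pmor F (xD (valP v)) a].

Fact cone_family_linear : linear cone_family.
Proof. by move=> a s t; apply/ffunP=> v; rewrite !ffunE linearP. Qed.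
HB.instance Definition _ :=
  GRing.isLinear.Build K (F x) (families D) *:%R
    cone_family cone_family_linear.

Fact cone_family_compatible a : cone_family a \in compatible (D := D).
Proof. by apply/asboolP=> u v h; rewrite !ffunE; apply/esym/pmor_comp. Qed.

Definition plim_cone : {linear F x -> plim D} :=
  corestr cone_family_compatible.

End Cone.

End Limits.

(** [cube k] is the type of [k]-cubes of vector spaces; the set of subsets of
    [{0, .., k-1}] is [{set 'I_k}], ordered by inclusion. *)
Definition cube (k : nat) := pmod {set 'I_k}.

Fact cube_nonempty k (S : {set 'I_k}) :
  S != set0 -> (set0 : {set 'I_k}) <= S.
Proof. by move=> _; apply: le0x. Qed.

Definition cartesian k (X : cube k) : Prop :=
  bijective (plim_cone X (D := fun S => S != set0) (@cube_nonempty k)).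

(** The inclusions [S |-> S] and [S |-> S `|` {k}] of the subsets of
    [{0, .., k-1}] into those of [{0, .., k}]. *)
Section Facets.
Variable k : nat.

Definition front (S : {set 'I_k}) : {set 'I_k.+1} :=
  widen_ord (leqnSn k) @: S.
Definition back (S : {set 'I_k}) : {set 'I_k.+1} := ord_max |: front S.

Fact front_homo : {homo front : S T / S <= T}.
Proof. move=> S T; exact: imsetS. Qed.
HB.instance Definition _ := Order.isOrderMorphism.Build
  _ {set 'I_k} _ {set 'I_k.+1} front front_homo.

Fact back_homo : {homo back : S T / S <= T}.
Proof. move=> S T /front_homo; exact: setUS. Qed.
HB.instance Definition _ := Order.isOrderMorphism.Build
  _ {set 'I_k} _ {set 'I_k.+1} back back_homo.

Fact front_back S : front S <= back S.
Proof. exact: subsetUr. Qed.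

Definition front_to_back (X : cube k.+1) : phom (ppull X front) (ppull X back).
Proof.
exists (fun S => pmor X (front_back S)) => S T h v.
by rewrite /=; apply: pmor_square.
Defined.

End Facets.

Arguments front {k} S.
Arguments back {k} S.

(** The total fiber is functorial in the cube, and is defined by recursion
    together with its action on morphisms of cubes. The recursion starts with
    the 0-cube, whose total fiber is its value at the empty set; the total fiber
    of a 1-cube is then the kernel of its edge. *)
Record cube_functor (k : nat) := CubeFunctor {
  cf_obj :> cube k -> lmodType K;
  cf_map : forall X Y : cube k, phom X Y -> {linear cf_obj X -> cf_obj Y};
  cf_square : forall (X Y Z W : cube k) (f : phom X Y) (g : phom Y W)
      (f' : phom X Z) (g' : phom Z W),
    (forall S v, g S (f S v) = g' S (f' S v)) ->
    forall t, cf_map g (cf_map f t) = cf_map g' (cf_map f' t)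
}.

Definition tfib0 : cube_functor 0 :=
  @CubeFunctor 0 (fun X => X set0) (fun X Y f => f set0)
    (fun X Y Z W f g f' g' e => e set0).

Section TotalFiberStep.
Variables (k : nat) (T : cube_functor k).

Definition tfibS_obj (X : cube k.+1) : lmodType K :=
  ker_space (cf_map T (front_to_back X)).

Fact tfibS_stable (X Y : cube k.+1) (f : phom X Y) t :
  t \in lin_ker (cf_map T (front_to_back X)) ->
  cf_map T (ppull_hom f front) t \in lin_ker (cf_map T (front_to_back Y)).
Proof.
rewrite !inE => /eqP t0.
rewrite (cf_square (f' := front_to_back X) (g' := ppull_hom f back)).
  by rewrite t0 linear0.
by move=> S v /=; rewrite phom_natural.
Qed.

Definition tfibS_map (X Y : cube k.+1) (f : phom X Y) :
    {linear tfibS_obj X -> tfibS_obj Y} :=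
  subspace_map (tfibS_stable f).

Fact tfibS_square (X Y Z W : cube k.+1) (f : phom X Y) (g : phom Y W)
    (f' : phom X Z) (g' : phom Z W) :
  (forall S v, g S (f S v) = g' S (f' S v)) ->
  forall t, tfibS_map g (tfibS_map f t) = tfibS_map g' (tfibS_map f' t).
Proof.
move=> e t; apply/val_inj => /=.
by apply: cf_square => S v; apply: e.
Qed.

Definition tfibS : cube_functor k.+1 := CubeFunctor tfibS_square.

End TotalFiberStep.

Fixpoint tfib (k : nat) : cube_functor k :=
  if k is k'.+1 then tfibS (tfib k') else tfib0.

(** For a cube in a lattice, all faces of dimension at least 2 are cartesian
    and cocartesian exactly when unions go to joins and intersections to
    meets. *)
Definition strongly_bicartesian d (P : latticeType d) k
    (X : {omorphism {set 'I_k} -> P}) : Prop :=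
  forall S T : {set 'I_k},
    X (S :|: T) = X S `|` X T /\ X (S :&: T) = X S `&` X T.

Definition degree d (P : latticeType d) (F : pmod P) (k : nat) : Prop :=
  forall X : {omorphism {set 'I_k.+1} -> P},
    strongly_bicartesian X -> cartesian (ppull F X).

Definition cross_degree d (P : latticeType d) (F : pmod P) (k : nat) : Prop :=
  forall X : {omorphism {set 'I_k.+1} -> P},
    strongly_bicartesian X -> forall t : tfib k.+1 (ppull F X), t = 0%R.

End PersistenceModules.

Definition embeds_in_orders d (P : porderType d) (k : nat) : Prop :=
  exists (dT : 'I_k -> Order.disp_t) (T : forall i, orderType (dT i))
         (f : forall i, P -> T i),
  forall x y : P, (x <= y) <-> (forall i, f i x <= f i y).

Definition order_dim d (P : porderType d) (n : nat) : Prop :=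
  embeds_in_orders P n /\ forall m, embeds_in_orders P m -> (n <= m)%N.

Section MeetDimension.
Variables (d : Order.disp_t) (P : finTBDistrLatticeType d).

Definition is_maximal (v : P) : bool := [forall u : P, ~~ (v < u)].

Definition meet_irreducible (v : P) : bool :=
  [forall x : P, forall y : P, (v < x) && (v < y) ==> (v != x `&` y)].

(** A top element is vacuously meet-irreducible; this does not affect the least
    [k], nor does allowing repetitions among the [k] elements. *)
Definition is_meet_of (v : P) (k : nat) : bool :=
  [exists s : k.-tuple P,
     all meet_irreducible s && (v == \meet_(x <- s) x)].

Fact ex_is_meet_of v : exists k, is_meet_of v k.
Proof.
have [m] := ubnP #|[set u : P | v < u]|; elim: m => // m IHm in v *.
rewrite ltnS => vm; case: (boolP (meet_irreducible v)) => [vI|].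
  exists 1; apply/existsP; exists [tuple v].
  by rewrite /= vI big_seq1 eqxx.
case/forallPn=> x /forallPn[y]; rewrite negb_imply negbK.
case/andP=> /andP[vx vy] /eqP vxy.
have lower w : v < w -> exists k, is_meet_of w k.
  move=> vw; apply: IHm; apply: leq_trans vm; apply: proper_card.
  apply/properP; split; last by exists w; rewrite !inE ?ltxx.
  by apply/subsetP=> u; rewrite !inE; apply: lt_trans.
have [k /existsP[s /andP[sI /eqP xs]]] := lower x vx.
have [l /existsP[t /andP[tI /eqP yt]]] := lower y vy.
exists (k + l); apply/existsP; exists [tuple of s ++ t].
by rewrite /= all_cat sI tI big_cat /= -xs -yt vxy eqxx.
Qed.

Definition mdim (v : P) : nat :=
  if is_maximal v then 0 else ex_minn (ex_is_meet_of v).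

End MeetDimension.

Section Truncation.
Variables (K : fieldType) (d : Order.disp_t) (P : finTBDistrLatticeType d).
Variables (k : nat) (F : pmod K P).

(** [trunc] is the pointwise formula for the right Kan extension along the
    inclusion of the elements of meet-dimension at most [k], and [Gamma] is the
    image of the canonical transformation [trunc_unit] into it. *)
Definition above (x : P) : pred P := fun v => (mdim v <= k)%N && (x <= v).

Fact above_ge x v : above x v -> x <= v.
Proof. by case/andP. Qed.

Fact above_le x y : x <= y -> forall v, above y v -> above x v.
Proof. by move=> xy v /andP[vk yv]; rewrite /above vk (le_trans xy yv). Qed.

Definition trunc_map x y (h : x <= y) :
    {linear plim F (above x) -> plim F (above y)} :=
  plim_restr F (above_le h).

Fact trunc_id x (h : x <= x) s : trunc_map h s = s.
Proof.
apply/val_inj/ffunP=> -[v vx]; rewrite ffunE /=.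
exact: (family_irrelevance (val s)).
Qed.

Fact trunc_comp x y z (h : x <= y) (h' : y <= z) (h'' : x <= z) s :
  trunc_map h'' s = trunc_map h' (trunc_map h s).
Proof.
apply/val_inj/ffunP=> -[v vz]; rewrite !ffunE /=.
exact: (family_irrelevance (val s)).
Qed.

Definition trunc : pmod K P :=
  @PMod K _ P (fun x => plim F (above x)) trunc_map trunc_id trunc_comp.

Fact trunc_unit_natural x y (h : x <= y) a :
  plim_cone F (@above_ge y) (pmor F h a) =
  trunc_map h (plim_cone F (@above_ge x) a).
Proof.
apply/val_inj/ffunP=> v; rewrite !ffunE /=; exact/esym/pmor_comp.
Qed.

Definition trunc_unit : phom F trunc :=
  @PHom K _ P F trunc (fun x => plim_cone F (@above_ge x)) trunc_unit_natural.

Definition Gamma : pmod K P := pimage trunc_unit.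

End Truncation.

(* Main.v *)
From HB Require Import structures.
Require Import Defs.
From mathcomp Require Import all_boot all_order all_algebra.
From mathcomp Require Import boolp.
From mathcomp Require classical_sets.

(** Why the theorem holds.

    To a [k]-cube of vector spaces belongs its total complex, which has the sum of
    the vertices of codimension [i] in degree [i]. Its homology in the two highest
    degrees is what the conditions of the theorem are about: it vanishes in degree
    [k] when the edges out of the initial vertex are jointly injective, that is,
    when the total fiber is zero ([acyclic_top], [tfib_eq0P]), and it also vanishes
    in degree [k - 1] when the cube is cartesian ([acyclic_glues], [cartesianP]).
    So, with [n = m + 2], degree [n - 1] and cross-degree [n - 2] assert the
    vanishing of the homology in degrees [> m] for the strongly bicartesian cubes
    of dimensions [m + 1] and [m + 2].

    Projective dimension and homology. Every module [Q] is a quotient of the sum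
    [pcover Q] of the modules with value [Q x] on the elements above [x], and this
    sum has no homology in positive degrees on cubes that preserve meets
    ([pcover_acyclic]). Projective modules are retracts of such sums, so dimension
    shifting along a resolution of length [m] kills the homology in degrees [> m]
    ([proj_dim_acyclic]). For the converse only the cubes spanned by the lower
    covers of the elements [x] matter: if their homology in degree 1 vanishes, then
    a lift defined below [x] extends to [x], so the module is projective
    ([projective_of_acyclic]); dimension shifting then turns vanishing in degree
    [m + 1] into a resolution of length [m] ([proj_dim_of_acyclic]). When the
    lattice has dimension at most [m + 2], an element has at most [m + 2] lower
    covers, because the cube they span contains a standard example
    ([lower_covers_bound]). The cubes to be tested thus have dimension at most
    [m + 2], and degree [n - 1] and cross-degree [n - 2] settle the two dimensions
    that are not trivial.

    Degree and truncation. The elements of meet-dimension at most [k] above the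
    initial vertex of a strongly bicartesian [(k + 1)]-cube lie above one of its
    atoms, since meet-irreducible elements are prime ([bicartesian_atom_le]). Hence
    the [k]-th truncation of any module has degree [k] ([degree_trunc]), and
    truncating the image [Gamma] gives cross-degree [n - 2]
    ([cross_degree_trunc_Gamma]). Conversely an element of meet-dimension [k] has
    at least [k] upper covers ([mdim_le_upper_covers]); testing the conditions on
    the cubes that they span shows, by downward induction, that the unit of the
    [(n - 1)]-st truncation is an isomorphism and the unit of the [(n - 2)]-nd one is
    injective ([trunc_unit_bijective], [trunc_unit_inj]). *)

Set Implicit Arguments.
Unset Strict Implicit.
Unset Printing Implicit Defensive.

Import Order.TTheory GRing.Theory.
Import Order.DefaultSetSubsetOrder.
Local Open Scope order_scope.

(** * Corner conditions on cubes of vector spaces *)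

Fact le_subset (T : finType) (A B : {set T}) : (A <= B) = (A \subset B).
Proof. by []. Qed.

Section CubeConditions.
Variable K : fieldType.

Section Transport.
Variables (d : Order.disp_t) (P : porderType d) (F : pmod K P).

Lemma pmor_irr x y (h h' : x <= y) : pmor F h =1 pmor F h'.
Proof. by move=> v; rewrite (bool_irrelevance h h'). Qed.

Lemma pmor_cancel x y (h : x <= y) (h' : y <= x) : cancel (pmor F h) (pmor F h').
Proof. by move=> v; rewrite -(pmor_comp h h' (lexx x)) pmor_id. Qed.

Lemma pmor_fam (a : forall x, F x) x y z (h : x <= z) (h' : y <= z) :
  x = y -> pmor F h (a x) = pmor F h' (a y).
Proof. by move=> xy; subst y; apply: pmor_irr. Qed.

End Transport.

Lemma linear_bijP (V W : lmodType K) (f : {linear V -> W}) :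
  bijective f <-> (forall v, f v = 0%R -> v = 0%R) /\ (forall w, exists v, f v = w).
Proof.
split=> [[g gK fK]|[f_inj f_surj]].
  split=> [v fv0|w]; last by exists (g w).
  by rewrite -(gK v) fv0 -(gK 0%R) linear0.
pose g w := sval (cid (f_surj w)).
have fg w : f (g w) = w by rewrite /g; case: cid.
exists g => // v; apply/eqP; rewrite -subr_eq0; apply/eqP/f_inj.
by rewrite linearB /= fg subrr.
Qed.

(** The families of a limit are indexed by a subtype; here they are functions of an
    element and a proof that it lies in the index set. *)
Lemma plim_cone_bijP d (P : finPOrderType d) (F : pmod K P) (D : pred P) x
    (xD : forall v, D v -> x <= v) :
  bijective (plim_cone F xD) <->
  (forall a : F x, (forall v (Dv : D v), pmor F (xD v Dv) a = 0%R) -> a = 0%R) /\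
  (forall s : (forall v, D v -> F v),
     (forall u v Du Dv (h : u <= v), pmor F h (s u Du) = s v Dv) ->
   exists a : F x, forall v (Dv : D v), pmor F (xD v Dv) a = s v Dv).
Proof.
rewrite linear_bijP; split=> -[inj surj]; split.
- move=> a a0; apply: inj; apply/val_inj/ffunP=> -[v Dv].
  by rewrite !ffunE /= a0.
- move=> s sc; pose t : dprod (fun v : {v : P | D v} => F (val v)) :=
    [ffun v => s (val v) (valP v)].
  have tc : t \in compatible (F := F) (D := D).
    by apply/asboolP=> u v h; rewrite !ffunE; apply: sc.
  have [a at_] := surj (exist _ t tc); exists a => v Dv.
  move/(congr1 val)/ffunP/(_ (exist _ v Dv)): at_; rewrite /= !ffunE /=.
  have -> : valP (exist (fun v => D v) v Dv) = Dv by apply: bool_irrelevance.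
  by [].
- move=> a a0; apply: inj => v Dv.
  move/(congr1 val)/ffunP/(_ (exist _ v Dv)): a0.
  by rewrite /= !ffunE /= => <-; apply: pmor_irr.
- move=> t; have /asboolP tc := valP t.
  have [u v Du Dv h|a at_] := surj (fun v Dv => val t (exist _ v Dv)).
    exact: (tc (exist _ u Du) (exist _ v Dv)).
  exists a; apply/val_inj/ffunP=> -[v Dv]; rewrite !ffunE /=.
  by rewrite -(at_ v Dv); apply: pmor_irr.
Qed.

Variable k : nat.
Implicit Types (X Y : cube K k) (S T : {set 'I_k}) (i j : 'I_k).

Fact le_set2l i j : [set i] <= [set i; j] :> {set 'I_k}.
Proof. by rewrite le_subset; apply/subsetP=> l; rewrite !inE => ->. Qed.

Fact le_set2r i j : [set j] <= [set i; j] :> {set 'I_k}.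
Proof. by rewrite le_subset; apply/subsetP=> l; rewrite !inE orbC => ->. Qed.

Fact le_set1 i S : i \in S -> [set i] <= S.
Proof. by move=> iS; apply/subsetP=> l; rewrite inE => /eqP->. Qed.

Definition jointly_injective X : Prop :=
  forall a : X set0, (forall i, pmor X (le0x [set i]) a = 0%R) -> a = 0%R.

Definition glues X : Prop :=
  forall b : (forall i, X [set i]),
    (forall i j, pmor X (le_set2l i j) (b i) = pmor X (le_set2r i j) (b j)) ->
  exists a : X set0, forall i, pmor X (le0x [set i]) a = b i.

(** A compatible family on the nonempty subsets is determined by its values at
    the singletons, and compatibility need only be tested at the pairs: any two
    elements of a nonempty subset generate a pair contained in it. *)
Lemma cartesianP X : cartesian X <-> jointly_injective X /\ glues X.
Proof.
rewrite /cartesian plim_cone_bijP; split=> -[Xinj Xsurj].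
- split=> [a a0|b b_eq].
    apply: Xinj => S S0; have /set0Pn[i iS] := S0.
    by rewrite (pmor_comp (le0x [set i]) (le_set1 iS)) a0 linear0.
  have pickP S : S != set0 -> {i | i \in S} by move=> /set0Pn/cid.
  pose s S (S0 : S != set0) :=
    pmor X (le_set1 (svalP (pickP S S0))) (b (sval (pickP S S0))).
  have sE i S (iS : i \in S) (S0 : S != set0) : s S S0 = pmor X (le_set1 iS) (b i).
    rewrite /s; case: (pickP _ _) => j jS /=.
    have ijS : [set i; j] <= S.
      by rewrite le_subset; apply/subsetP=> l; rewrite !inE => /orP[]/eqP->.
    rewrite (pmor_comp (le_set2l i j) ijS) b_eq.
    exact: pmor_comp.
  have [S T S0 T0 h|a aE] := Xsurj s.
    have /set0Pn[i iS] := S0.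
    have iT : i \in T by move: h; rewrite le_subset => /subsetP; apply.
    rewrite (sE i S iS) (sE i T iT); exact/esym/pmor_comp.
  exists a => i; have i0 : [set i] != set0 by apply/set0Pn; exists i; rewrite inE.
  have := aE _ i0; rewrite (sE i _ (set11 i)) pmor_id => <-; exact: pmor_irr.
- have i0 i : [set i] != set0 by apply/set0Pn; exists i; rewrite inE.
  split=> [a a0|s sc].
    by apply: Xinj => i; rewrite -(a0 _ (i0 i)); apply: pmor_irr.
  have [i j|a aE] := Xsurj (fun i => s _ (i0 i)).
    have ij0 : [set i; j] != set0 by apply/set0Pn; exists i; rewrite !inE eqxx.
    by rewrite (sc _ _ _ ij0) (sc _ _ _ ij0).
  exists a => S S0; have /set0Pn[i iS] := S0.
  by rewrite (pmor_comp (le0x [set i]) (le_set1 iS)) aE; apply: sc.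
Qed.

End CubeConditions.

(** The total fiber, defined facet by facet, sits inside the initial vertex as
    the common kernel of the edges out of it. *)
Lemma tfib_embedding (K : fieldType) (k : nat) :
  exists e : forall X : cube K k, tfib K k X -> X set0,
  [/\ forall X Y (f : phom X Y) t, e Y (cf_map (tfib K k) f t) = f set0 (e X t),
      forall X, e X 0%R = 0%R,
      forall X, injective (e X)
    & forall (X : cube K k) (a : X set0), (exists t, e X t = a) <->
        (forall i, pmor X (le0x [set i]) a = 0%R)].
Proof.
elim: k => [|k [e [e_nat e_0 e_inj e_im]]].
  exists (fun (X : cube K 0) t => t); split=> // [X t u //|X a].
  by split=> [_ []|_] //; exists a.
have front0 : front (set0 : {set 'I_k}) = set0 by apply: imset0.
have h0 : front (set0 : {set 'I_k}) <= set0 by rewrite front0.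
have back0 : back (set0 : {set 'I_k}) = [set ord_max].
  by rewrite /back front0 setU0.
have front1 j : front [set j] = [set widen_ord (leqnSn k) j] by apply: imset_set1.
exists (fun (X : cube K k.+1) (t : tfibS_obj (tfib K k) X) =>
  pmor X h0 (e (ppull X (@front k)) (val t))); split.
- by move=> X Y f t; rewrite /= e_nat /=; apply: esym; apply: phom_natural.
- by move=> X; rewrite /= e_0 linear0.
- move=> X t u tu; apply/val_inj/e_inj.
  exact: (can_inj (pmor_cancel (F := X) h0 (le0x _)) tu).
move=> X a; split=> [[t <-] i|a0].
  case: (unliftP ord_max i) => [j|] ->.
    have /(_ j) := (e_im _ (e _ (val t))).1 (ex_intro _ _ erefl).
    have h1 : front [set j] <= [set lift ord_max j].
      rewrite front1; suff -> : widen_ord (leqnSn k) j = lift ord_max j by [].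
      by apply/val_inj; rewrite /= /bump leqNgt ltn_ord.
    move/(congr1 (pmor X h1)); rewrite linear0 => <-; exact: pmor_square.
  have h1 : back (set0 : {set 'I_k}) <= [set ord_max] by rewrite back0.
  have /eqP := valP t; move/(congr1 (e _)); rewrite e_nat e_0.
  move/(congr1 (pmor X h1)); rewrite linear0 => <-; exact: pmor_square.
pose a' : ppull X (@front k) set0 := pmor X (le0x (front set0)) a.
have [t te] : exists t, e _ t = a'.
  apply/e_im => j; have h1 : [set widen_ord (leqnSn k) j] <= front [set j].
    by rewrite front1.
  rewrite -(linear0 (pmor X h1)) -(a0 (widen_ord (leqnSn k) j)) /=.
  exact: pmor_square.
have tK : cf_map (tfib K k) (front_to_back X) t = 0%R.
  apply: e_inj; rewrite e_nat e_0 te.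
  have h1 : [set ord_max] <= back (set0 : {set 'I_k}) by rewrite back0.
  rewrite -(linear0 (pmor X h1)) -(a0 ord_max) /=; exact: pmor_square.
exists (exist _ t (introT eqP tK)).
by rewrite /= te (pmor_cancel (le0x _) h0).
Qed.

Lemma tfib_eq0P (K : fieldType) (k : nat) (X : cube K k) :
  (forall t : tfib K k X, t = 0%R) <-> jointly_injective X.
Proof.
have [e [_ e_0 e_inj e_im]] := tfib_embedding K k.
split=> [t0 a /e_im[t <-]|Xinj t]; first by rewrite (t0 t) e_0.
by apply: e_inj; rewrite e_0; apply: Xinj; apply/e_im; exists t.
Qed.

(** * The total complex of a cube *)

Section DependentFamilies.
Variables (K : fieldType) (I : finType) (V : I -> lmodType K).

Lemma dprod_choose (Q : forall i, V i -> Prop) :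
  (forall i, exists v, Q i v) -> exists a : dprod V, forall i, Q i (a i).
Proof.
move=> /(_ _)/cid QP; exists [ffun i => sval (QP i)] => i.
by rewrite ffunE; case: (QP i).
Qed.

Lemma dprod_delta i (v : V i) :
  exists a : dprod V, (forall j, j != i -> a j = 0%R) /\ a i = v.
Proof.
have [j|a aP] := @dprod_choose (fun j u => (j != i -> u = 0%R) /\
    forall e : i = j, u = ecast j (V j) e v).
  case: (eqVneq i j) => [e|ij]; last by exists 0%R; split=> // e; rewrite e eqxx in ij.
  subst j; exists v; split=> [/eqP //|e].
  by rewrite eq_axiomK.
exists a; split=> [j|]; first exact: (aP j).1.
exact: ((aP i).2 erefl).
Qed.

End DependentFamilies.

Section TotalComplex.
Variables (K : fieldType) (k : nat).
Implicit Types (X Y : cube K k) (S T : {set 'I_k}) (i j l : 'I_k).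
Local Open Scope ring_scope.

Definition koszul_sign T j : K := (-1) ^+ #|[set l in T | (l < j)%N]|.

Lemma koszul_sign_sq T j : koszul_sign T j * koszul_sign T j = 1.
Proof. by rewrite -expr2 sqrr_sign. Qed.

(** Deleting the smaller of two indices lowers the position of the larger one,
    while deleting the larger one leaves the position of the smaller one. *)
Lemma koszul_sign_anti T j l : j \in T -> l \in T -> j != l ->
  koszul_sign T j * koszul_sign (T :\ j) l =
  - (koszul_sign T l * koszul_sign (T :\ l) j).
Proof.
wlog jl : j l / (j < l)%N => [IH jT lT jNl|jT lT _].
  case: (ltngtP j l) => [jl|lj|/val_inj jl].
  - exact: IH.
  - by apply: oppr_inj; rewrite opprK; apply/esym/IH; rewrite // eq_sym.
  - by rewrite jl eqxx in jNl.
have -> : koszul_sign (T :\ l) j = koszul_sign T j.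
  congr (_ ^+ _); apply: eq_card => x; rewrite !inE.
  by case: eqVneq => //= ->; rewrite lT /= ltnNge ltnW.
have -> : koszul_sign T l = - koszul_sign (T :\ j) l.
  rewrite /koszul_sign (cardsD1 j) !inE jT jl add1n exprS mulN1r.
  congr (- (_ ^+ _)).
  by apply: eq_card => x; rewrite !inE andbA.
by rewrite mulNr opprK mulrC.
Qed.

Fact le_setD1 T j : (T :\ j <= T)%O.
Proof. exact: subD1set. Qed.

Section Differential.
Variable X : cube K k.
Local Notation chain := (dprod (fun S : {set 'I_k} => X S)).
Implicit Types a b : chain.

(** All the chains are kept in one space, the product of all the vertices; the
    chains of degree [i] are those carried by the vertices of codimension [i]. *)
Definition boundary a : chain :=
  [ffun T : {set 'I_k} =>
     \sum_(j in T) koszul_sign T j *: pmor X (le_setD1 T j) (a (T :\ j))].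

Fact boundary_linear : linear boundary.
Proof.
move=> c a b; apply/ffunP=> T; rewrite !ffunE scaler_sumr -big_split /=.
apply: eq_bigr => j _; rewrite dprodD dprodZ linearP scalerDr !scalerA.
by rewrite mulrC.
Qed.
HB.instance Definition _ :=
  GRing.isLinear.Build K chain chain *:%R boundary boundary_linear.

(** The terms cancel in pairs, by exchanging the order in which two indices are
    deleted; the double sum is split by comparing the two indices, so that the
    argument works in characteristic 2 as well. *)
Lemma boundary_sq a : boundary (boundary a) = 0.
Proof.
apply/ffunP=> T; rewrite ffunE dprod0.
have hT j l : ((T :\ j) :\ l <= T)%O.
  exact: subset_trans (le_setD1 _ _) (le_setD1 _ _).
pose f j l := (koszul_sign T j * koszul_sign (T :\ j) l) *:
  pmor X (hT j l) (a ((T :\ j) :\ l)).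
have -> : \sum_(j in T) koszul_sign T j *:
    pmor X (le_setD1 T j) (boundary a (T :\ j)) =
    \sum_(j < k) \sum_(l < k) (if [&& j \in T, l \in T & j != l] then f j l else 0).
  rewrite [LHS]big_mkcond; apply: eq_bigr => j _; case: ifP => jT /=; last first.
    by rewrite big1.
  rewrite ffunE linear_sum scaler_sumr /= [LHS]big_mkcond; apply: eq_bigr => l _.
  rewrite !inE eq_sym andbC; case: ifP => // _.
  by rewrite linearZ scalerA /f -(pmor_comp _ _ (hT j l)).
have -> : \sum_(j < k) \sum_(l < k)
     (if [&& j \in T, l \in T & j != l] then f j l else 0) =
   \sum_(j < k) \sum_(l < k | (j < l)%N) (if (j \in T) && (l \in T) then f j l else 0) +
   \sum_(j < k) \sum_(l < k | (l < j)%N) (if (j \in T) && (l \in T) then f j l else 0).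
  rewrite -big_split; apply: eq_bigr => j _ /=.
  rewrite (bigID (fun l => (j < l)%N)) /=; congr (_ + _).
    by apply: eq_bigr => l jl; rewrite neq_ltn jl andbT.
  rewrite [LHS]big_mkcond [RHS]big_mkcond; apply: eq_bigr => l _.
  rewrite -leqNgt leq_eqVlt -(inj_eq val_inj) neq_ltn.
  by case: ltngtP; rewrite /= ?andbT ?andbF.
rewrite [X in _ + X](exchange_big_dep predT) //= -big_split big1 //= => j _.
rewrite -big_split big1 //= => l jl.
rewrite [(l \in T) && _]andbC; case: ifP => [/andP[jT lT]|_]; last by rewrite addr0.
rewrite /f (koszul_sign_anti jT lT) ?neq_ltn ?jl // scaleNr.
rewrite (pmor_fam a (hT j l) (hT l j)) ?addNr //.
by apply/setP=> x; rewrite !inE andbCA.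
Qed.

Definition homogeneous (i : nat) a : Prop :=
  forall S, (#|S| + i)%N != k -> a S = 0.

Lemma homogeneous_boundary (i : nat) a :
  homogeneous i.+1 a -> homogeneous i (boundary a).
Proof.
move=> ai T Ti; rewrite ffunE big1 // => j jT; rewrite ai ?linear0 ?scaler0 //.
by rewrite (cardsD1 j) jT add1n addSnnS in Ti.
Qed.

(** Vanishing of the homology of the total complex in degree [i]. *)
Definition acyclic (i : nat) : Prop :=
  forall a, homogeneous i a -> boundary a = 0 -> exists b, boundary b = a.

(** A chain with a homogeneous boundary may be cut down to its component of the
    right degree without changing that boundary. *)
Lemma acyclic_homogeneous (i : nat) a :
  acyclic i -> homogeneous i a -> boundary a = 0 ->
  exists2 b, homogeneous i.+1 b & boundary b = a.
Proof.
move=> Xi ai /(Xi a ai)[b ba].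
exists [ffun S : {set 'I_k} => if (#|S| + i.+1 == k)%N then b S else 0].
  by move=> S /negPf Si; rewrite ffunE Si.
apply/ffunP=> T; case: (eqVneq (#|T| + i)%N k) => Ti.
  rewrite -ba !ffunE; apply: eq_bigr => j jT; rewrite ffunE.
  by rewrite (cardsD1 j) jT add1n addSnnS in Ti; rewrite Ti eqxx.
rewrite (ai T Ti) (homogeneous_boundary _ Ti) // => S /negPf Si.
by rewrite ffunE Si.
Qed.

Lemma acyclic_gt (i : nat) : (k < i)%N -> acyclic i.
Proof.
move=> ki a ai _; exists 0; rewrite linear0; apply/ffunP=> S.
rewrite dprod0 ai //; apply: contraTneq ki => <-.
by rewrite -leqNgt leq_addl.
Qed.

End Differential.

Lemma boundary_map X Y (f : phom X Y) a :
  boundary (dprod_map f a) = dprod_map f (boundary a) :> dprod (fun S => Y S).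
Proof.
apply/ffunP=> T; rewrite !ffunE linear_sum; apply: eq_bigr => j _ /=.
by rewrite linearZ /= ffunE phom_natural.
Qed.

End TotalComplex.

Section ShortExactSequence.
Variables (K : fieldType) (k : nat) (A B C : cube K k).
Variables (f : phom A B) (g : phom B C).
Hypothesis f_inj : forall S, injective (f S).
Hypothesis fg_exact : pexact f g.
Hypothesis g_surj : pepi g.
Local Open Scope ring_scope.

Local Notation chain X := (dprod (fun S : {set 'I_k} => X S)).

Fact chain_map_inj : injective (dprod_map f).
Proof.
move=> a a' /ffunP e; apply/ffunP=> S; apply: (@f_inj S).
by have := e S; rewrite !ffunE.
Qed.

Fact chain_map_exact (b : chain B) :
  dprod_map g b = 0 <-> exists a : chain A, dprod_map f a = b.
Proof.
split=> [/ffunP gb|[a <-]].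
  have [S|a ab] := @dprod_choose K _ (fun S : {set 'I_k} => A S)
      (fun S v => f S v = b S).
    by apply/(fg_exact (b S)); have := gb S; rewrite !ffunE.
  by exists a; apply/ffunP=> S; rewrite ffunE ab.
by apply/ffunP=> S; rewrite !ffunE; apply/fg_exact; exists (a S).
Qed.

Fact chain_map_lift (i : nat) (c : chain C) : homogeneous i c ->
  exists2 b : chain B, homogeneous i b & dprod_map g b = c.
Proof.
move=> ci.
have [S|b bc] := @dprod_choose K _ (fun S : {set 'I_k} => B S)
    (fun S v => g S v = c S /\ ((#|S| + i)%N != k -> v = 0)).
  case: (eqVneq (#|S| + i)%N k) => Si.
    by have [v vc] := g_surj (c S); exists v.
  by exists 0; rewrite linear0 ci.
exists b => [S Si|]; first exact: (bc S).2.
by apply/ffunP=> S; rewrite ffunE (bc S).1.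
Qed.

Fact chain_map_surj (c : chain C) : exists b : chain B, dprod_map g b = c.
Proof.
have [S|b bc] := @dprod_choose K _ (fun S : {set 'I_k} => B S)
    (fun S v => g S v = c S); first exact: g_surj.
by exists b; apply/ffunP=> S; rewrite ffunE bc.
Qed.

(** The two lemmas below are the fragments of the long exact homology sequence
    in which the middle term contributes nothing. *)
Lemma acyclic_quotient (i : nat) : acyclic A i -> acyclic B i.+1 -> acyclic C i.+1.
Proof.
move=> Ai Bi c ci c0; have [b bi bc] := chain_map_lift ci.
have [a ab] : exists a, dprod_map f a = boundary b.
  by apply/chain_map_exact; rewrite -boundary_map bc.
have ai : homogeneous i a.
  move=> S Si; apply: (@f_inj S); rewrite linear0.
  have := homogeneous_boundary bi Si; by rewrite -ab ffunE.
have a0 : boundary a = 0.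
  by apply: chain_map_inj; rewrite -boundary_map ab boundary_sq linear0.
have [a' a'i a'a] := acyclic_homogeneous Ai ai a0.
have [S Si||b' b'b] := Bi (b - dprod_map f a').
- by rewrite !ffunE bi // a'i // linear0 subr0.
- by rewrite linearB /= boundary_map a'a ab subrr.
exists (dprod_map g b'); rewrite boundary_map b'b linearB /= bc.
by rewrite (_ : dprod_map g _ = 0) ?subr0 //; apply/chain_map_exact; exists a'.
Qed.

Lemma acyclic_sub (i : nat) : acyclic C i.+1 -> acyclic B i -> acyclic A i.
Proof.
move=> Ci Bi a ai a0.
have fai : homogeneous i (dprod_map f a : chain B).
  by move=> S Si; rewrite ffunE ai // linear0.
have fa0 : boundary (dprod_map f a : chain B) = 0.
  by rewrite boundary_map a0 linear0.
have [b bi ba] := acyclic_homogeneous Bi fai fa0.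
have [S Si||c cb] := Ci (dprod_map g b).
- by rewrite ffunE bi // linear0.
- by rewrite boundary_map ba; apply/chain_map_exact; exists a.
have [b' b'c] := chain_map_surj c.
have [a' a'b] : exists a', dprod_map f a' = b - boundary b'.
  by apply/chain_map_exact; rewrite linearB /= -boundary_map b'c cb subrr.
exists a'; apply: chain_map_inj; rewrite -boundary_map a'b.
by rewrite linearB /= ba boundary_sq subr0.
Qed.

End ShortExactSequence.

Section ChainEnds.
Variables (K : fieldType) (k : nat).
Implicit Types (S T : {set 'I_k}) (i j l : 'I_k).
Local Open Scope ring_scope.

Lemma boundary_set1 (X : cube K k) (a : dprod (fun S : {set 'I_k} => X S)) i :
  boundary a [set i] = pmor X (le0x [set i]) (a set0).
Proof.
rewrite ffunE big_set1 (_ : koszul_sign K [set i] i = 1) ?scale1r.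
  by apply: pmor_fam; apply/setP=> l; rewrite !inE andNb.
rewrite /koszul_sign (_ : [set l in [set i] | _] = set0) ?cards0 //.
by apply/setP=> l; rewrite !inE; case: eqVneq => //= ->; rewrite ltnn.
Qed.

Lemma boundary_set2 (X : cube K k) (a : dprod (fun S : {set 'I_k} => X S)) i j :
  (i < j)%N -> boundary a [set i; j] =
  pmor X (le_set2r i j) (a [set j]) - pmor X (le_set2l i j) (a [set i]).
Proof.
move=> ij; have iNj : i != j by rewrite neq_ltn ij.
rewrite ffunE big_setU1 ?inE //= big_set1.
have -> : koszul_sign K [set i; j] i = 1.
  rewrite /koszul_sign (_ : [set l in _ | _] = set0) ?cards0 //.
  apply/setP=> l; rewrite !inE; apply/negbTE.
  by apply/andP=> -[/orP[]/eqP->]; rewrite ?ltnn // ltnNge ltnW.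
have -> : koszul_sign K [set i; j] j = -1.
  rewrite /koszul_sign (_ : [set l in _ | _] = [set i]) ?cards1 //.
  apply/setP=> l; rewrite !inE; case: eqVneq => [->|_] //=.
  by case: eqVneq => //= ->; rewrite ltnn.
rewrite scale1r scaleN1r; congr (_ - _); apply: pmor_fam.
  by apply/setP=> l; rewrite !inE; case: eqVneq => [->|] //=; rewrite (negPf iNj).
apply/setP=> l; rewrite !inE; case: eqVneq => [->|] //=; rewrite ?orbF //.
by rewrite eq_sym (negPf iNj).
Qed.

(** In the highest degree the complex has only the initial vertex, and the
    boundary consists of the edges out of it. *)
Lemma acyclic_top (X : cube K k) : acyclic X k <-> jointly_injective X.
Proof.
split=> [Xk v v0|Xinj a ak a0]; last first.
  exists 0; rewrite linear0; apply/ffunP=> S; rewrite dprod0.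
  case: (eqVneq S set0) => [->|S0]; last first.
    by rewrite ak // -[X in _ != X]add0n eqn_add2r cards_eq0.
  by apply/esym/Xinj => i; rewrite -boundary_set1 a0 dprod0.
have [a [a0 av]] := dprod_delta (V := fun S : {set 'I_k} => X S) v.
have [S Sk||b ba] := Xk a.
- by apply: a0; rewrite -cards_eq0; rewrite -[X in _ != X]add0n eqn_add2r in Sk.
- apply/ffunP=> T; rewrite dprod0; case: (eqVneq #|T| 1%N) => [/eqP/cards1P[i ->]|T1].
    by rewrite boundary_set1 av v0.
  rewrite ffunE big1 // => j jT; rewrite a0 ?linear0 ?scaler0 //.
  by rewrite (cardsD1 j) jT add1n eqSS cards_eq0 in T1.
by rewrite -av -ba ffunE big_set0.
Qed.

End ChainEnds.

(** One degree lower, the chains are families on the singletons, and the boundary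
    at a pair is the difference of the two restrictions: the cycles are the
    compatible families. *)
Lemma acyclic_glues (K : fieldType) (k : nat) (X : cube K k.+1) :
  acyclic X k <-> glues X.
Proof.
have hom (a : dprod (fun S : {set 'I_k.+1} => X S)) : homogeneous k a <->
    (forall S : {set 'I_k.+1}, #|S| != 1%N -> a S = 0%R).
  have e (S : {set 'I_k.+1}) : (#|S| + k != k.+1)%N = (#|S| != 1%N).
    by congr (~~ _); apply: (eqn_add2r k _ 1%N).
  by split=> aS S; have := aS S; rewrite e.
split=> [Xk b bE|Xg a /hom ak a0].
  have [S|a aP] := @dprod_choose K _ (fun S : {set 'I_k.+1} => X S)
      (fun S u => (#|S| != 1%N -> u = 0%R) /\
      forall i (h : [set i] <= S), S = [set i] -> u = pmor X h (b i)).
    case: (eqVneq #|S| 1%N) => [/eqP/cards1P[i ->]|S1].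
      exists (b i); split=> // j h /set1_inj ij; subst j; by rewrite pmor_id.
    by exists 0%R; split=> // i h e; rewrite e cards1 in S1.
  have ab i : a [set i] = b i by rewrite ((aP _).2 i (lexx _)) ?pmor_id.
  have [||c ca] := Xk a.
  - by apply/hom=> S; apply: (aP S).1.
  - apply/ffunP=> T; rewrite dprod0.
    case: (eqVneq #|T| 2) => [/eqP/cards2P[i [j [ij ->]]]|T2].
      wlog lt_ij : i j ij / (i < j)%N => [IH|].
        case: (ltngtP i j) => [|ji|/val_inj e]; first exact: IH.
          by rewrite setUC; apply: IH; rewrite // eq_sym.
        by rewrite e eqxx in ij.
      by rewrite boundary_set2 // !ab bE subrr.
    rewrite ffunE big1 // => j jT; rewrite (aP _).1 ?linear0 ?scaler0 //.
    by rewrite (cardsD1 j) jT add1n eqSS in T2.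
  by exists (c set0) => i; rewrite -boundary_set1 ca ab.
have [i j|v va] := Xg (fun i => a [set i]).
  have lt_ij (i' j' : 'I_k.+1) : (i' < j')%N -> pmor X (le_set2l i' j') (a [set i']) =
      pmor X (le_set2r i' j') (a [set j']).
    move=> ij; apply/esym/eqP; rewrite -subr_eq0 -boundary_set2 //.
    by rewrite a0 dprod0.
  case: (ltngtP i j) => [|ji|/val_inj e]; first exact: lt_ij.
    have h : [set j; i] <= [set i; j] by rewrite setUC.
    rewrite (pmor_comp (le_set2r j i) h) -(lt_ij j i ji).
    exact/esym/pmor_comp.
  by subst j; apply: pmor_irr.
have [b [b0 bv]] := dprod_delta (V := fun S : {set 'I_k.+1} => X S) v.
exists b; apply/ffunP=> T.
case: (eqVneq #|T| 1%N) => [/eqP/cards1P[i ->]|T1].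
  by rewrite boundary_set1 bv va.
rewrite ak // ffunE big1 // => j jT; rewrite b0 ?linear0 ?scaler0 //.
by rewrite (cardsD1 j) jT add1n eqSS cards_eq0 in T1.
Qed.

(** * Persistence modules over a finite poset *)

Section Constructions.
Variables (K : fieldType) (d : Order.disp_t) (P : finPOrderType d).
Implicit Types F G Q : pmod K P.
Local Open Scope ring_scope.

Section Kernel.
Variables (F G : pmod K P) (f : phom F G).

Fact pker_stable x y (h : (x <= y)%O) v :
  v \in lin_ker (f x) -> pmor F h v \in lin_ker (f y).
Proof. by rewrite !inE phom_natural => /eqP->; rewrite linear0. Qed.

Definition pker_map x y (h : (x <= y)%O) :
    {linear ker_space (f x) -> ker_space (f y)} :=
  subspace_map (pker_stable h).

Fact pker_id x (h : (x <= x)%O) v : pker_map h v = v.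
Proof. by apply/val_inj; rewrite /= pmor_id. Qed.
Fact pker_comp x y z (h : (x <= y)%O) (h' : (y <= z)%O) (h'' : (x <= z)%O) v :
  pker_map h'' v = pker_map h' (pker_map h v).
Proof. by apply/val_inj; rewrite /= -pmor_comp. Qed.

Definition pker : pmod K P :=
  @PMod K _ P (fun x => ker_space (f x)) pker_map pker_id pker_comp.

Definition pker_incl : phom pker F.
Proof. by exists (fun x => val : {linear ker_space (f x) -> F x}). Defined.

Lemma pker_incl_inj x : injective (pker_incl x).
Proof. exact: val_inj. Qed.

Lemma pker_incl_exact : pexact pker_incl f.
Proof.
move=> x v; split=> [fv0|[w <-]]; last exact/eqP/(valP w).
by exists (exist _ v (introT eqP fv0)).
Qed.

End Kernel.

Definition pid F : phom F F.
Proof. by exists (fun x => idfun : {linear F x -> F x}). Defined.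

Definition pcompose F G H (g : phom G H) (f : phom F G) : phom F H.
Proof.
exists (fun x => (g x \o f x)%FUN : {linear F x -> H x}).
by move=> x y h v; rewrite /= !phom_natural.
Defined.

Lemma piso_of_bijective F G (f : phom F G) : (forall x, bijective (f x)) -> piso F G.
Proof.
move=> f_bij; have f_inj x : injective (f x) by apply: bij_inj.
pose g x w := sval (cid (((linear_bijP (f x)).1 (f_bij x)).2 w)).
have fg x : cancel (g x) (f x) by move=> w; rewrite /g; case: cid.
have g_lin x : linear (g x).
  by move=> a u v; apply: (f_inj x); rewrite linearP !fg.
pose gl x : {linear G x -> F x} := HB.pack (g x)
  (GRing.isLinear.Build _ _ _ _ (g x) (g_lin x)).
have g_nat x y (h : (x <= y)%O) v : gl y (pmor G h v) = pmor F h (gl x v).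
  by apply: (f_inj y); rewrite phom_natural !fg.
exists f, (PHom g_nat); split=> x; last exact: fg.
by move=> v; apply: (f_inj x); rewrite fg.
Qed.

End Constructions.

(** * Modules acyclic on meet-preserving cubes *)

Section Contraction.
Variables (K : fieldType) (k : nat) (V : lmodType K) (A : {set 'I_k} -> V).
Variable j : 'I_k.
Implicit Type T : {set 'I_k}.
Local Open Scope ring_scope.

(** In the augmented cochain complex of a simplex, adjoining a fixed vertex is a
    contracting homotopy; it sends a cocycle to a preimage. *)
Lemma simplex_contraction :
  (forall T, \sum_(l in T) koszul_sign K T l *: A (T :\ l) = 0) ->
  forall T, \sum_(l in T) koszul_sign K T l *:
    (if j \in T :\ l then 0 else koszul_sign K (j |: T :\ l) j *: A (j |: T :\ l))
    = A T.
Proof.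
move=> A0 T; case: (boolP (j \in T)) => jT.
  rewrite (bigD1 j) //= !inE eqxx /= setD1K // scalerA koszul_sign_sq scale1r.
  rewrite big1 ?addr0 // => l /andP[_ lj].
  by rewrite !inE eq_sym lj jT scaler0.
have jU : (j |: T) :\ j = T by rewrite setU1K.
have lU l : l \in T -> (j |: T) :\ l = j |: T :\ l.
  move=> lT; apply/setP=> x; rewrite !inE.
  case: (eqVneq x j) => [->|] //=; rewrite ?orbF ?andbT //.
  by apply: contraTneq jT => ->; rewrite negbK.
have := A0 (j |: T); rewrite big_setU1 //= jU => /eqP; rewrite addr_eq0 => /eqP AT.
rewrite -[RHS]scale1r -(koszul_sign_sq K (j |: T) j) -scalerA AT -sumrN scaler_sumr.
apply: eq_bigr => l lT; rewrite !inE (negPf jT) andbF -lU // scalerN !scalerA -scaleNr.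
congr (_ *: _).
have jl : j != l by apply: contraNneq jT => ->.
have := @koszul_sign_anti K k (j |: T) j l; rewrite jU.
move: (koszul_sign K T l) => t anti.
rewrite -[LHS]mul1r -(koszul_sign_sq K (j |: T) j) -mulrA.
rewrite [X in _ * X]mulrA anti ?inE ?eqxx ?lT ?orbT // !mulNr mulrN.
by rewrite -mulrA koszul_sign_sq mulr1.
Qed.

End Contraction.

Section Cover.
Variables (K : fieldType) (d : Order.disp_t) (P : finPOrderType d).
Local Open Scope ring_scope.

Definition meet_stable k (X : {set 'I_k} -> P) : Prop :=
  forall y S T, (y <= X S)%O -> (y <= X T)%O -> (y <= X (S :&: T))%O.

Variable Q : pmod K P.
Local Notation families := (dprod (fun x : P => Q x)).

Definition supported_below (y : P) : {pred families} :=
  [pred f : families | [forall x, ~~ (x <= y)%O ==> (f x == 0)]].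

Fact supported_belowP y (f : families) :
  reflect (forall x, ~~ (x <= y)%O -> f x = 0) (f \in supported_below y).
Proof.
apply: (iffP forallP) => fy x; last by apply/implyP=> /fy ->.
by move=> xy; apply/eqP; move: (fy x); rewrite xy.
Qed.

Fact supported_below_closed y : submod_closed (supported_below y).
Proof.
split=> [|a f g /supported_belowP f0 /supported_belowP g0];
  apply/supported_belowP=> x xy.
  by rewrite dprod0.
by rewrite dprodD dprodZ f0 // g0 // scaler0 addr0.
Qed.
HB.instance Definition _ y :=
  GRing.isSubmodClosed.Build K families (supported_below y) (supported_below_closed y).

Fact supported_below_le y z (h : (y <= z)%O) f :
  f \in supported_below y ->
  (idfun : {linear families -> families}) f \in supported_below z.
Proof.
move=> /supported_belowP f0; apply/supported_belowP=> x xz; apply: f0.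
by apply: contra xz => /le_trans; apply.
Qed.

Definition pcover_map y z (h : (y <= z)%O) :
    {linear subspace (V := families) (supported_below y) ->
            subspace (V := families) (supported_below z)} :=
  subspace_map (supported_below_le h).

Fact pcover_id y (h : (y <= y)%O) f : pcover_map h f = f.
Proof. exact/val_inj. Qed.
Fact pcover_comp x y z (h : (x <= y)%O) (h' : (y <= z)%O) (h'' : (x <= z)%O) f :
  pcover_map h'' f = pcover_map h' (pcover_map h f).
Proof. exact/val_inj. Qed.

(** The direct sum over [x] of the modules with value [Q x] on the elements above
    [x] and identity structure maps. Families on the whole of [P] with a support
    condition realize it inside a fixed space, where the structure maps are
    inclusions. *)
Definition pcover : pmod K P :=
  @PMod K _ P (fun y => subspace (V := families) (supported_below y))
    pcover_map pcover_id pcover_comp.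

(** The structure maps of [Q], extended by zero to all pairs of elements, so that
    sums may run over the whole of [P]. *)
Definition pmor0 x y : {linear Q x -> Q y} :=
  match @idP (x <= y)%O with
  | ReflectT h => pmor Q h
  | ReflectF _ => \0%R
  end.

Lemma pmor0_le x y (h : (x <= y)%O) v : pmor0 x y v = pmor Q h v.
Proof. by rewrite /pmor0; case: {-}_ / idP => // h'; apply: pmor_irr. Qed.

Definition pcover_sum y (f : pcover y) : Q y := \sum_x pmor0 x y (val f x).

Fact pcover_sum_linear y : linear (@pcover_sum y).
Proof.
move=> a f g; rewrite /pcover_sum scaler_sumr -big_split; apply: eq_bigr => x _ /=.
by rewrite -linearZ -linearD /= dprodD dprodZ.
Qed.
HB.instance Definition _ y :=
  GRing.isLinear.Build K (pcover y) (Q y) *:%R (@pcover_sum y) (@pcover_sum_linear y).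

Definition pcover_proj : phom pcover Q.
Proof.
exists (fun y => @pcover_sum y : {linear pcover y -> Q y}) => y z h f.
rewrite /= /pcover_sum linear_sum; apply: eq_bigr => x _ /=.
case: (boolP (x <= y)%O) => xy.
  by rewrite (pmor0_le xy) (pmor0_le (le_trans xy h)); apply: pmor_comp.
by rewrite (supported_belowP _ _ (valP f) _ xy) !linear0.
Defined.

Lemma pcover_proj_epi : pepi pcover_proj.
Proof.
move=> y v.
have [f [f0 fy]] := dprod_delta (V := fun x : P => Q x) v.
have fP : f \in supported_below y.
  by apply/supported_belowP=> x xy; apply: f0; apply: contraNneq xy => ->.
exists (exist _ f fP); rewrite /= /pcover_sum (bigD1 y) //= big1 ?addr0.
  by rewrite fy (pmor0_le (lexx y)) pmor_id.
by move=> x xy; rewrite f0 ?linear0.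
Qed.

End Cover.

Section CoverAcyclic.
Variables (K : fieldType) (d : Order.disp_t) (P : finPOrderType d).
Variables (Q : pmod K P) (k : nat) (X : {omorphism {set 'I_k} -> P}).
Local Open Scope ring_scope.

Fact pcover_boundary (a : dprod (fun S : {set 'I_k} => ppull (pcover Q) X S)) T y :
  val (boundary a T) y =
  \sum_(j in T) koszul_sign K T j *: (val (a (T :\ j)) y : Q y).
Proof.
rewrite ffunE (big_morph (fun s : pcover Q (X T) => val s y : Q y)
    (id1 := 0) (op1 := +%R)) /=.
- by apply: eq_bigr => j _; rewrite dprodZ.
- by move=> s t; rewrite dprodD.
- by rewrite dprod0.
Qed.

(** Componentwise: the vertices of a meet-preserving cube that lie above a given
    [y] form a principal filter of the cube of subsets. Unless it is the top vertex
    alone, it is closed under adding and removing some index, which contracts the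
    complex. *)
Lemma pcover_acyclic (i : nat) : meet_stable X -> acyclic (ppull (pcover Q) X) i.+1.
Proof.
move=> XI a ai a0; pose A y (S : {set 'I_k}) : Q y := val (a S) y.
have A0 y S : ~~ (y <= X S)%O -> A y S = 0.
  by move=> yS; rewrite /A (supported_belowP _ _ (valP (a S)) _ yS).
have dA y (T : {set 'I_k}) : \sum_(j in T) koszul_sign K T j *: A y (T :\ j) = 0.
  by rewrite -pcover_boundary a0 dprod0 /= dprod0.
(* An index [j] with [y] below the coatom opposite to [j] is one that may be
   removed from any vertex above [y]. *)
pose c y (S : {set 'I_k}) : Q y := if [pick j | y <= X (~: [set j])]%O is Some j then
  (if j \in S then 0 else koszul_sign K (j |: S) j *: A y (j |: S)) else 0.
have c0 y S : ~~ (y <= X S)%O -> c y S = 0.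
  rewrite /c; case: pickP => // j yj yS; case: ifP => // jS.
  rewrite A0 ?scaler0 //; apply: contra yS => yS.
  have := XI _ _ _ yS yj; rewrite setIUl setICr set0U => /le_trans; apply.
  by apply: omorph_le; apply: subsetIl.
have [S|b bP] := @dprod_choose K _ (fun S : {set 'I_k} => ppull (pcover Q) X S)
    (fun S u => forall y, val u y = c y S).
  pose f : dprod (fun x : P => Q x) := [ffun y => c y S].
  have fS : f \in supported_below (X S).
    by apply/supported_belowP=> y yS; rewrite ffunE c0.
  by exists (exist _ f fS) => y; rewrite ffunE.
exists b; apply/ffunP=> T; apply/val_inj/ffunP=> y.
rewrite pcover_boundary; under eq_bigr do rewrite bP.
rewrite -/(A y T) /c; case: pickP => [j yj|yX]; first exact: simplex_contraction.
rewrite big1 => [|l _]; last exact: scaler0.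
apply/esym; case: (eqVneq T setT) => [->|].
  by rewrite /A ai ?dprod0 // cardsT card_ord -[X in _ != X]addn0 eqn_add2l.
rewrite -subTset => /subsetPn[j _ jT]; apply: A0; apply/negP => yT.
have /negP[] := negbT (yX j); apply: le_trans yT _; apply: omorph_le.
by rewrite le_subset subsetC sub1set inE.
Qed.

End CoverAcyclic.

Section DimensionShifting.
Variables (K : fieldType) (d : Order.disp_t) (P : finPOrderType d).
Variables (k : nat) (X : {omorphism {set 'I_k} -> P}).
Implicit Types F Q : pmod K P.
Local Open Scope ring_scope.

(** A projective module is a retract of its cover. *)
Lemma projective_acyclic Q (i : nat) : meet_stable X -> projective Q ->
  acyclic (ppull Q X) i.+1.
Proof.
move=> XI Qproj a ai a0.
have [s ps] := Qproj _ _ _ (pid Q) (@pcover_proj_epi K d P Q).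
have [S Si||b ba] := pcover_acyclic (Q := Q) (i := i) XI
    (a := dprod_map (ppull_hom s X) a).
- by rewrite ffunE ai // linear0.
- by rewrite boundary_map a0 linear0.
exists (dprod_map (ppull_hom (pcover_proj Q) X) b).
rewrite boundary_map ba; apply/ffunP=> S; rewrite !ffunE /=.
exact: (ps _ (a S)).
Qed.

Lemma acyclic_of_ker Q F (f : phom Q F) (i : nat) : pepi f ->
  acyclic (ppull (pker f) X) i -> acyclic (ppull Q X) i.+1 ->
  acyclic (ppull F X) i.+1.
Proof.
move=> f_epi; apply: (acyclic_quotient (f := ppull_hom (pker_incl f) X)
    (g := ppull_hom f X)) => [S|S v|S v].
- by move=> u v /val_inj.
- exact: pker_incl_exact.
- exact: f_epi.
Qed.

Lemma acyclic_ker Q F (f : phom Q F) (i : nat) : pepi f ->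
  acyclic (ppull F X) i.+1 -> acyclic (ppull Q X) i -> acyclic (ppull (pker f) X) i.
Proof.
move=> f_epi; apply: (acyclic_sub (f := ppull_hom (pker_incl f) X)
    (g := ppull_hom f X)) => [S|S v|S v].
- by move=> u v /val_inj.
- exact: pker_incl_exact.
- exact: f_epi.
Qed.

Lemma pzero_acyclic F (i : nat) : pzero F -> acyclic (ppull F X) i.
Proof.
move=> F0 a _ _; exists 0; rewrite linear0; apply/ffunP=> S.
by rewrite dprod0; apply/esym/F0.
Qed.

(** Dimension shifting along the resolution: the kernel of the augmentation has a
    resolution shorter by one, and is zero when the resolution has length zero. *)
Lemma proj_dim_acyclic F (m i : nat) : meet_stable X -> proj_dim_le F m ->
  (m < i)%N -> acyclic (ppull F X) i.
Proof.
move=> XI; elim: m F i => [|m IH] F [//|i] [Q [dif [aug [Qproj Q0 aug_epi ex0 ex]]]] mi.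
  apply: (acyclic_of_ker aug_epi); last exact: projective_acyclic.
  apply: pzero_acyclic => x v; have [w wv] := (ex0 x (val v)).1 (eqP (valP v)).
  by apply: val_inj; rewrite -wv (Q0 1%N isT x w) linear0.
apply: (acyclic_of_ker aug_epi); last exact: projective_acyclic.
apply: IH => //; exists (fun j => Q j.+1), (fun j => dif j.+1).
have aug'P x v : dif 0%N x v \in lin_ker (aug x).
  by apply/eqP/ex0; exists v.
have aug'N x y (h : (x <= y)%O) v :
    (corestr (aug'P y) : {linear _ -> pker aug y}) (pmor (Q 1%N) h v) =
    pmor (pker aug) h (corestr (aug'P x) v).
  by apply/val_inj; rewrite /= phom_natural.
exists (PHom aug'N); split=> [j|j mj|x v|x v|j] //.
- exact: Q0.
- have [w wv] := (ex0 x (val v)).1 (eqP (valP v)).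
  by exists w; apply/val_inj.
- rewrite -ex; split=> [/(congr1 val)|v0] //; exact/val_inj.
Qed.

End DimensionShifting.

(** * Lifting linear maps *)

Section LinearLift.
Variables (K : fieldType) (U V W : lmodType K).
Variables (p : {linear U -> W}) (f : {linear V -> W}).
Hypothesis p_surj : forall w, exists u, p u = w.
Local Open Scope ring_scope.

(** The graph of a lift of [f] through [p] defined on a subspace of [V]. *)
Definition partial_lift (R : V * U -> Prop) : Prop :=
  [/\ R (0, 0),
      forall c v u v' u', R (v, u) -> R (v', u') -> R (c *: v + v', c *: u + u'),
      forall u, R (0, u) -> u = 0
    & forall v u, R (v, u) -> p u = f v].

Fact partial_lift_functional R v u u' :
  partial_lift R -> R (v, u) -> R (v, u') -> u = u'.
Proof.
move=> [_ Rlin R0 _] vu vu'; apply/eqP; rewrite -subr_eq0; apply/eqP/R0.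
have := Rlin (-1) v u' v u vu' vu.
by rewrite !scaleN1r [- v + v]addNr [- u' + u]addrC.
Qed.

Fact partial_lift_adjoin A v u0 : partial_lift A -> (forall u, ~ A (v, u)) ->
  p u0 = f v ->
  partial_lift (fun x => exists c w z, A (w, z) /\ x = (c *: v + w, c *: u0 + z)).
Proof.
move=> [A0 Alin A00 Ap] vA pu0; split.
- by exists 0, 0, 0; rewrite !scale0r !addr0.
- move=> c _ _ _ _ [c1 [w1 [z1 [A1 [-> ->]]]]] [c2 [w2 [z2 [A2 [-> ->]]]]].
  exists (c * c1 + c2), (c *: w1 + w2), (c *: z1 + z2); split; first exact: Alin.
  by rewrite !scalerDr !scalerA !scalerDl; congr (_, _); apply: addrACA.
- move=> u [c [w [z [Awz [/esym vw ->]]]]].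
  have [c0|c0] := eqVneq c 0.
    by move: vw Awz; rewrite c0 !scale0r !add0r => -> /A00.
  case: (vA (- c^-1 *: z)); have := Alin (- c^-1) w z 0 0 Awz A0.
  rewrite !addr0; congr (A (_, _)).
  move/eqP: vw; rewrite addrC addr_eq0 => /eqP->.
  by rewrite scalerN scaleNr opprK scalerA mulVf ?scale1r.
- by move=> _ _ [c [w [z [Awz [-> ->]]]]]; rewrite !linearP /= pu0 (Ap _ _ Awz).
Qed.

(** By the Zorn lemma there is a maximal partial lift, and it is defined everywhere:
    the value at one more vector can be chosen freely in a fiber of [p]. *)
Lemma linear_lift (R : V * U -> Prop) : partial_lift R ->
  exists g : {linear V -> U},
    (forall v, p (g v) = f v) /\ (forall v u, R (v, u) -> g v = u).
Proof.
move=> Rlift.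
pose good A := partial_lift A /\ (forall x, R x -> A x).
(* The empty set is admitted because it is the union of the empty chain. *)
have [F Fgood Ftot|A [A_or Amax]] := @classical_sets.Zorn_bigcup (V * U)
    (fun A => A = classical_sets.set0 \/ good A).
  have [[S0 FS0 [S0lift S0R]]|Fno] := pselect (exists2 S, F S & good S); last first.
    left; apply/classical_sets.seteqP; split=> // x [S FS Sx].
    by case: (Fgood S FS) => [S_0|Sg]; [rewrite S_0 in Sx|case: Fno; exists S].
  have Fin S x : F S -> S x -> good S.
    by move=> FS Sx; case: (Fgood S FS) => // S_0; rewrite S_0 in Sx.
  right; split; last by move=> x Rx; exists S0 => //; apply: S0R.
  split.
  - by exists S0 => //; case: S0lift.
  - move=> c v u v' u' [S FS Sx] [T FT Tx].
    have [ST|TS] := Ftot S T FS FT.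
      exists T => //; have [[_ Tlin _ _] _] := Fin T _ FT Tx.
      by apply: Tlin => //; apply: ST.
    exists S => //; have [[_ Slin _ _] _] := Fin S _ FS Sx.
    by apply: Slin => //; apply: TS.
  - by move=> u [S FS Sx]; have [[_ _ S00 _] _] := Fin S _ FS Sx; apply: S00.
  - by move=> v u [S FS Sx]; have [[_ _ _ Sp] _] := Fin S _ FS Sx; apply: Sp.
have [Alift AR] : good A.
  case: A_or => // A0; case: (Amax R); last by right; split.
  rewrite A0; split=> [x []|] R0; have [R00 _ _ _] := Rlift.
  exact: (R0 _ R00).
have A_total v : exists u, A (v, u).
  apply: contrapT => /forallNP vA; have [u0 pu0] := p_surj (f v).
  set B := fun x => exists c w z, A (w, z) /\ x = (c *: v + w, c *: u0 + z).
  have AB x : A x -> B x.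
    by case: x => w z Awz; exists 0, w, z; rewrite !scale0r !add0r.
  case: (Amax B); last first.
    by right; split=> [|x /AR/AB //]; apply: partial_lift_adjoin.
  split=> [x /AB //|BA]; case: (vA u0); apply: BA.
  by have [A0 _ _ _] := Alift; exists 1, 0, 0; rewrite !scale1r !addr0.
pose g v := sval (cid (A_total v)).
have gA v : A (v, g v) by rewrite /g; case: cid.
have g_lin : linear g.
  move=> c v v'; apply: (partial_lift_functional Alift (gA _)).
  by have [_ Alin _ _] := Alift; apply: Alin.
exists (HB.pack g (GRing.isLinear.Build _ _ _ _ g g_lin) : {linear V -> U}).
split=> [v|v u Rvu] /=; first by have [_ _ _ Ap] := Alift; apply: Ap.
exact: (partial_lift_functional Alift (gA v) (AR _ Rvu)).
Qed.

End LinearLift.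

(** * Cubes of covers in a distributive lattice *)

Section Covers.
Variables (d : Order.disp_t) (P : finTBDistrLatticeType d).
Implicit Types x y z c : P.

Definition covered_by x y : bool := (x < y) && [forall z, ~~ ((x < z) && (z < y))].

Lemma covered_byP x y :
  reflect (x < y /\ forall z, x < z -> z <= y -> z = y) (covered_by x y).
Proof.
apply: (iffP andP) => -[xy H]; split=> //.
  move=> z xz zy; apply/eqP; rewrite -[_ == _]negbK; apply/negP=> zNy.
  by have /forallP/(_ z)/negP[] := H; rewrite xz lt_neqAle zNy zy.
apply/forallP=> z; apply/negP=> /andP[xz zy].
by have := H z xz (ltW zy) => zE; rewrite zE ltxx in zy.
Qed.

Lemma exists_upper_cover x y : x < y -> exists2 c, covered_by x c & c <= y.
Proof.
move=> xy; pose A c := (x < c) && (c <= y).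
have Ay : A y by rewrite /A xy lexx.
case: (arg_minnP (fun c => #|[set w : P | w <= c]|) Ay) => c /andP[xc cy] cmin.
exists c => //; apply/covered_byP; split=> // z xz zc.
apply/eqP; rewrite eq_le zc /=; have /cmin : A z by rewrite /A xz (le_trans zc cy).
have zcS : [set w : P | w <= z] \subset [set w | w <= c].
  by apply/subsetP=> w; rewrite !inE => /le_trans; apply.
move=> card; have /eqP/setP/(_ c) : [set w : P | w <= z] == [set w | w <= c].
  by rewrite eqEcard zcS card.
by rewrite !inE lexx.
Qed.

Lemma exists_lower_cover x y : x < y -> exists2 c, covered_by c y & x <= c.
Proof.
move=> xy; pose A c := (x <= c) && (c < y).
have Ax : A x by rewrite /A xy lexx.
case: (arg_minnP (fun c => #|[set w : P | c <= w]|) Ax) => c /andP[xc cy] cmin.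
exists c => //; apply/covered_byP; split=> // z cz zy.
have [//|zNy] := eqVneq z y.
have /cmin : A z by rewrite /A (le_trans xc (ltW cz)) lt_neqAle zy zNy.
rewrite leqNgt => /negP[]; apply: proper_card; apply/properP; split.
  by apply/subsetP=> w; rewrite !inE; apply: le_trans (ltW cz).
by exists c; rewrite !inE ?lexx // (lt_geF cz).
Qed.

Lemma upper_covers_meet x c c' : covered_by x c -> covered_by x c' -> c != c' ->
  c `&` c' = x.
Proof.
move=> /covered_byP[xc cP] /covered_byP[xc' cP'].
apply: contraNeq => cc'.
have xm : x < c `&` c' by rewrite lt_neqAle eq_sym cc' lexI !ltW.
by rewrite -(cP _ xm (leIl _ _)) {1}(cP' _ xm (leIr _ _)).
Qed.

Lemma lower_covers_join x c c' : covered_by c x -> covered_by c' x -> c != c' ->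
  c `|` c' = x.
Proof.
move=> /covered_byP[cx cP] /covered_byP[cx' cP'] cc'.
have jx : c `|` c' <= x by rewrite leUx !ltW.
have [cj|] := boolP (c < c `|` c'); first exact: cP.
have [cj'|] := boolP (c' < c `|` c'); first by move=> _; apply: cP'.
rewrite !lt_neqAle leUl leUr !andbT !negbK => /eqP c'E /eqP cE.
by rewrite cE -c'E eqxx in cc'.
Qed.

End Covers.

Section CoverCubes.
Variables (d : Order.disp_t) (P : finTBDistrLatticeType d).
Variables (k : nat) (x : P) (c : 'I_k -> P).
Implicit Types S T : {set 'I_k}.

Definition join_cube S : P := x `|` \join_(i in S) c i.
Definition meet_cube S : P := x `&` \meet_(i | i \notin S) c i.

Fact join_cube_homo : {homo join_cube : S T / S <= T}.
Proof.
move=> S T ST; apply: leU2 => //; apply/joinsP=> i iS; apply: joins_sup.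
by move: ST; rewrite le_subset => /subsetP; apply.
Qed.
HB.instance Definition _ := Order.isOrderMorphism.Build
  _ {set 'I_k} _ P join_cube join_cube_homo.

Fact meet_cube_homo : {homo meet_cube : S T / S <= T}.
Proof.
move=> S T ST; apply: leI2 => //; apply/meetsP=> i iS; apply: meets_inf.
by apply: contra iS; move: ST; rewrite le_subset => /subsetP; apply.
Qed.
HB.instance Definition _ := Order.isOrderMorphism.Build
  _ {set 'I_k} _ P meet_cube meet_cube_homo.

Lemma join_cube0 : join_cube set0 = x.
Proof. by rewrite /join_cube big_set0 joinx0. Qed.

Lemma join_cube1 i : x <= c i -> join_cube [set i] = c i.
Proof. by move=> xi; rewrite /join_cube big_set1; apply: join_r. Qed.

Lemma meet_cubeT : meet_cube setT = x.
Proof. by rewrite /meet_cube big1 ?meetx1 // => i; rewrite inE. Qed.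

Lemma meet_cubeD1 i : c i <= x -> meet_cube (setT :\ i) = c i.
Proof.
move=> ix; rewrite /meet_cube (big_pred1 i); first exact: meet_r.
by move=> j; rewrite !inE andbT negbK.
Qed.

Lemma meet_cube_lt S i : i \notin S -> c i < x -> meet_cube S < x.
Proof.
move=> iS; apply: le_lt_trans; apply: le_trans (leIr _ _) _; exact: meets_inf.
Qed.

Lemma meet_cubeI S T : meet_cube (S :&: T) = meet_cube S `&` meet_cube T.
Proof.
rewrite /meet_cube meetACA meetxx; congr (_ `&` _); apply/le_anti/andP; split.
  rewrite lexI; apply/andP; split; apply/meetsP=> i iS; apply: meets_inf.
    by rewrite inE negb_and iS.
  by rewrite inE negb_and iS orbT.
apply/meetsP=> i; rewrite inE negb_and => /orP[]iS.
  by apply: leIxl; apply: meets_inf.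
by apply: leIxr; apply: meets_inf.
Qed.

Lemma meet_cube_stable : meet_stable meet_cube.
Proof. by move=> y S T yS yT; rewrite meet_cubeI lexI yS yT. Qed.

(** Unions give joins by construction; for intersections, distribute the meet of
    the two joins and use that two different [c i] meet in [x]. *)
Lemma join_cube_bicartesian : (forall i j, i != j -> c i `&` c j = x) ->
  strongly_bicartesian (join_cube : {omorphism _ -> _}).
Proof.
move=> cI S T; split; first by rewrite /= /join_cube joins_setU joinACA joinxx.
apply/le_anti/andP; split.
  rewrite lexI; apply/andP; split; apply: join_cube_homo;
    [exact: subsetIl|exact: subsetIr].
rewrite /= /join_cube -joinIr leUx leUl.
rewrite /= (big_endo _ (fun u v => meetUl u v _) (meet0x _)).
apply/joinsP=> i iS.
rewrite (big_endo _ (meetUr (c i)) (meetx0 _)).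
apply/joinsP=> j jT.
have [ij|/cI->] := eqVneq i j; last exact: leUl.
subst j; rewrite meetxx; apply: lexUr.
by apply: joins_sup; rewrite inE iS.
Qed.

Lemma meet_cube_bicartesian : (forall i j, i != j -> c i `|` c j = x) ->
  strongly_bicartesian (meet_cube : {omorphism _ -> _}).
Proof.
move=> cU S T; split; last exact: meet_cubeI.
apply/le_anti/andP; split; last first.
  rewrite leUx; apply/andP; split; apply: meet_cube_homo;
    [exact: subsetUl|exact: subsetUr].
rewrite /= /meet_cube -meetUr lexI leIl.
rewrite /= (big_endo _ (fun u v => joinIl u v _) (join1x _)).
apply/meetsP=> i iS.
rewrite (big_endo _ (joinIr (c i)) (joinx1 _)).
apply/meetsP=> j jT.
have [ij|/cU->] := eqVneq i j; last exact: leIl.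
subst j; rewrite joinxx; apply: leIxr.
by apply: meets_inf; rewrite inE negb_or iS.
Qed.

End CoverCubes.

(** * Order dimension, covers and meet-dimension *)

Section DimensionBounds.
Variables (d : Order.disp_t) (P : finTBDistrLatticeType d).
Implicit Types x y z c : P.

(** The pairs [u i], [w i] form a standard example: each of them must be reversed
    by some linear order, and no linear order reverses two of them. *)
Lemma standard_example_bound n k (u w : 'I_k -> P) : embeds_in_orders P n ->
  (forall i j, i != j -> u i <= w j) -> (forall i, ~~ (u i <= w i)) -> (k <= n)%N.
Proof.
move=> [dT [T [f fP]]] uw uNw.
have /(_ _)/cid r i : exists t, ~~ (f t (u i) <= f t (w i)).
  apply: contrapT => /forallNP H; have /negP[] := uNw i; apply/fP => t.
  by apply: contrapT => /negP; apply: H.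
pose t i := sval (r i).
have tP i : f (t i) (w i) < f (t i) (u i) by rewrite ltNge; apply: (svalP (r i)).
have t_inj : injective t.
  move=> i j tij; apply: contrapT => /eqP ij.
  have wj := tP j; rewrite -tij in wj.
  have ui_wj := (fP _ _).1 (uw i j ij) (t i).
  have uj_wi : f (t i) (u j) <= f (t i) (w i) 
    by apply: (fP _ _).1; apply: uw; rewrite eq_sym.
  by have := lt_trans (tP i) (le_lt_trans ui_wj (lt_le_trans wj uj_wi)); rewrite ltxx.
by have := leq_card t t_inj; rewrite !card_ord.
Qed.

(** In a cube, the atoms and the complementary coatoms form a standard example. *)
Lemma cube_bound n k (X : {omorphism {set 'I_k} -> P}) :
  embeds_in_orders P n ->
  (forall i, ~~ (X [set i] <= X (~: [set i]))) -> (k <= n)%N.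
Proof.
move=> Pn; apply: standard_example_bound Pn _ => i j ij.
by apply: omorph_le; rewrite le_subset sub1set !inE.
Qed.

Definition upper_covers x : {set P} := [set c | covered_by x c].
Definition lower_covers x : {set P} := [set c | covered_by c x].

Lemma exists_upper_covers x k : (k <= #|upper_covers x|)%N ->
  exists c : 'I_k -> P,
  [/\ injective c, forall i, covered_by x (c i)
    & k = #|upper_covers x| -> forall y, x < y -> exists i, c i <= y].
Proof.
move=> kx; pose c (i : 'I_k) := enum_val (widen_ord kx i); exists c; split.
- move=> i j /enum_val_inj e; apply/val_inj; exact: (congr1 val e).
- by move=> i; have := enum_valP (widen_ord kx i); rewrite inE.
move=> kE y /exists_upper_cover[a xa ay].
have aU : a \in upper_covers x by rewrite inE.
exists (cast_ord (esym kE) (enum_rank_in aU a)).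
rewrite /c (_ : widen_ord _ _ = enum_rank_in aU a) ?enum_rankK_in //.
exact/val_inj.
Qed.

Definition lower_cover x (i : 'I_#|lower_covers x|) : P := enum_val i.

Lemma lower_coverP x i : covered_by (@lower_cover x i) x.
Proof. by have := enum_valP i; rewrite inE. Qed.

Lemma exists_lower_cover_ge x y : y < x -> exists i, y <= @lower_cover x i.
Proof.
move=> /exists_lower_cover[a ax ya]; have aL : a \in lower_covers x by rewrite inE.
by exists (enum_rank_in aL a); rewrite /lower_cover enum_rankK_in.
Qed.

Definition lower_cube x : {omorphism {set 'I_#|lower_covers x|} -> P} :=
  meet_cube x (@lower_cover x).

Lemma lower_cube_bicartesian x : strongly_bicartesian (lower_cube x).
Proof.
apply: meet_cube_bicartesian => i j ij.
apply: lower_covers_join; try exact: lower_coverP.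
by apply: contraNneq ij => /enum_val_inj->.
Qed.

Lemma covered_lt x y : covered_by x y -> x < y.
Proof. by case/covered_byP. Qed.

Lemma lower_covers_bound n x : embeds_in_orders P n -> (#|lower_covers x| <= n)%N.
Proof.
move=> Pn; apply: (cube_bound Pn (X := lower_cube x)) => i.
have ix := covered_lt (lower_coverP i).
have := (@lower_cube_bicartesian x [set i] (~: [set i])).1.
rewrite setUCr /= meet_cubeT -setTD (meet_cubeD1 (ltW ix)) => xE.
by apply/negP => /join_r; rewrite -xE => e; rewrite -e ltxx in ix.
Qed.

Lemma upper_cube_bicartesian x k (c : 'I_k -> P) : injective c ->
  (forall i, covered_by x (c i)) ->
  strongly_bicartesian (join_cube x c : {omorphism _ -> _}).
Proof.
move=> c_inj xc; apply: join_cube_bicartesian => i j ij.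
by apply: upper_covers_meet; rewrite ?(inj_eq c_inj).
Qed.

Lemma upper_covers_bound n x : embeds_in_orders P n -> (#|upper_covers x| <= n)%N.
Proof.
move=> Pn; have [c [c_inj xc _]] := exists_upper_covers (leqnn #|upper_covers x|).
apply: (cube_bound Pn (X := join_cube x c)) => i.
have xi := covered_lt (xc i).
have := (upper_cube_bicartesian c_inj xc [set i] (~: [set i])).2.
rewrite setICr /= join_cube0 (join_cube1 (ltW xi)) => xE.
by apply/negP => /meet_l; rewrite -xE => e; rewrite -e ltxx in xi.
Qed.

(** An element maximal among those above [x] and not above [c] is meet-irreducible:
    everything strictly above it is above [c]. *)
Lemma exists_separating_irreducible x c : ~~ (c <= x) ->
  exists m, [/\ meet_irreducible m, x <= m & ~~ (c <= m)].
Proof.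
move=> cx; pose A m := (x <= m) && ~~ (c <= m).
have Ax : A x by rewrite /A lexx.
case: (arg_maxnP (fun m => #|[set w : P | w <= m]|) Ax) => m /andP[xm cm] mmax.
have above y : m < y -> c <= y.
  move=> my; apply: contraT => cy.
  have /mmax : A y by rewrite /A cy (le_trans xm (ltW my)).
  rewrite /= leqNgt => /negP[]; apply: proper_card; apply/properP; split.
    by apply/subsetP=> w; rewrite !inE => /le_trans; apply; apply: ltW.
  by exists y; rewrite !inE ?lexx // (lt_geF my).
exists m; split=> //; apply/forallP=> a; apply/forallP=> b; apply/implyP=> /andP[ma mb].
by apply: contraNneq cm => ->; rewrite lexI !above.
Qed.

(** For each upper cover take a meet-irreducible element above [x] that separates
    it from [x]; if their meet were larger than [x], it would lie above an upper
    cover. *)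
Lemma mdim_le_upper_covers x : (mdim x <= #|upper_covers x|)%N.
Proof.
rewrite /mdim; case: ifP => // _; case: ex_minnP => k _; apply.
have sep c : exists m, c \in upper_covers x ->
    [/\ meet_irreducible m, x <= m & ~~ (c <= m)].
  have [cU|] := boolP (c \in upper_covers x); last by exists x.
  rewrite inE in cU; have [|m mP] := @exists_separating_irreducible x c.
    by rewrite (lt_geF (covered_lt cU)).
  by exists m.
have [m mP] := choice sep.
apply/existsP; exists [tuple of map m (enum_tuple (mem (upper_covers x)))].
apply/andP; split.
  by apply/allP=> m' /mapP[c]; rewrite mem_enum => /mP[mI _ _] ->.
rewrite big_map; set y := \meet_(_ <- _) _.
have xy : x <= y.
  by apply/meetsP_seq => c; rewrite mem_enum => /mP[].
rewrite eq_le xy /=; apply: contraT => yx.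
have [|c xc cy] := @exists_upper_cover _ _ x y.
  by rewrite lt_neqAle xy andbT; apply: contraNneq yx => <-.
have cU : c \in upper_covers x by rewrite inE.
have [_ _ /negP[]] := mP c cU; apply: le_trans cy _.
by apply: meets_inf_seq; rewrite // mem_enum.
Qed.

Lemma meet_irreducible_prime (a b m : P) : meet_irreducible m -> a `&` b <= m ->
  (a <= m) || (b <= m).
Proof.
move=> /forallP/(_ (m `|` a))/forallP/(_ (m `|` b))/implyP mI abm.
apply: contraT; rewrite negb_or => /andP[am bm].
have lt_join z : ~~ (z <= m) -> m < m `|` z.
  move=> zm; rewrite lt_neqAle leUl andbT; apply: contraNneq zm => ->.
  exact: leUr.
have := mI; rewrite !lt_join // -joinIr => /(_ isT)/eqP[].
exact/esym/join_l.
Qed.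

Lemma mdim_is_meet (v : P) : is_meet_of v (mdim v).
Proof.
rewrite /mdim; case: ifP => [/forallP vmax|_]; last by case: ex_minnP.
apply/existsP; exists [tuple]; rewrite /= big_nil.
by have := vmax \top; rewrite lt_neqAle lex1 andbT negbK.
Qed.

(** Each of the [mdim v] meet-irreducible elements with meet [v] is prime, hence
    misses at most one atom of the cube; with more atoms than irreducible elements,
    some atom lies below all of them. *)
Lemma bicartesian_atom_le k (X : {omorphism {set 'I_k} -> P}) (v : P) :
  strongly_bicartesian X -> (mdim v < k)%N -> X set0 <= v ->
  exists i, X [set i] <= v.
Proof.
move=> Xb vk Xv; have /existsP[s /andP[/allP sI /eqP vE]] := mdim_is_meet v.
apply: contrapT => /forallNP H.
have /(_ _)/cid r i : exists t, ~~ (X [set i] <= tnth s t).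
  apply: contrapT => /forallNP Hi; apply: (H i).
  rewrite vE; apply/meetsP_seq => _ /tnthP[t ->] _.
  by apply: contrapT => /negP; apply: Hi.
pose t i := sval (r i).
have t_inj : injective t.
  move=> i j tij; apply/eqP; apply: contraT => ij.
  have bi := svalP (r i); have := svalP (r j).
  rewrite -[sval (r i)]/(t i) -[sval (r j)]/(t j) -tij in bi * => bj.
  suff : (X [set i] <= tnth s (t i)) || (X [set j] <= tnth s (t i)).
    by rewrite (negPf bi) (negPf bj).
  apply: meet_irreducible_prime; first by apply: sI; apply: mem_tnth.
  rewrite -(Xb _ _).2 (_ : [set i] :&: [set j] = set0); last first.
    by apply/setP=> l; rewrite !inE; case: eqVneq => // ->; rewrite (negPf ij).
  apply: le_trans Xv _; rewrite {1}vE; apply: meets_inf_seq => //; exact: mem_tnth.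
by have := leq_card t t_inj; rewrite !card_ord leqNgt vk.
Qed.

End DimensionBounds.

(** * Bounding the projective dimension *)

Section ProjectivityCriterion.
Variables (K : fieldType) (d : Order.disp_t) (P : finTBDistrLatticeType d).
Local Open Scope ring_scope.

Lemma lower_cube_lt (x : P) S : S != setT -> (lower_cube x S < x)%O.
Proof.
rewrite -subTset => /subsetPn[j _ jS].
exact: meet_cube_lt jS (covered_lt (lower_coverP j)).
Qed.

Lemma lower_cubeT (x : P) : lower_cube x setT = x.
Proof. exact: meet_cubeT. Qed.

Section Extension.
Variables (M F G : pmod K P) (p : phom F G) (f : phom M G).
Hypothesis p_epi : pepi p.
Variables (x : P) (g : forall y, {linear M y -> F y}).
Hypothesis g_nat : forall y z (h : (y <= z)%O), (z < x)%O ->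
  forall v, g z (pmor M h v) = pmor F h (g y v).
Hypothesis g_lift : forall y, (y < x)%O -> forall v, p y (g y v) = f y v.

Local Notation X := (lower_cube x).
Local Notation chain N := (dprod (fun S => ppull N X S)).

Fact map_boundary (a : chain M) T : T != setT ->
  boundary (dprod_map (fun S => g (X S)) a : chain F) T = g (X T) (boundary a T).
Proof.
move=> TT; rewrite !ffunE linear_sum; apply: eq_bigr => j _.
by rewrite ffunE linearZ /= g_nat //; apply: lower_cube_lt.
Qed.

Fact top_le : (X setT <= x)%O. Proof. by rewrite lower_cubeT. Qed.
Fact le_top : (x <= X setT)%O. Proof. by rewrite lower_cubeT. Qed.

Fact setTD1_neq j : [set: 'I_#|lower_covers x|] :\ j != setT.
Proof. by rewrite -subTset; apply/subsetPn; exists j; rewrite !inE ?eqxx. Qed.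

(** The values forced on the images of the lower covers of [x] are consistent
    exactly because the relations among these images come from pairs of lower
    covers, where the lift is already natural. *)
Lemma extend_lift : acyclic (ppull M X) 1 ->
  exists h : {linear M x -> F x}, (forall v, p x (h v) = f x v) /\
    forall y (yx : (y <= x)%O), (y < x)%O ->
    forall v, h (pmor M yx v) = pmor F yx (g y v).
Proof.
move=> M1.
(* [gc] need not commute with the boundary at the top vertex, where the lift is
   still to be defined; everywhere else it does, by naturality of [g]. *)
pose gc : {linear chain M -> chain F} := dprod_map (fun S => g (X S)).
pose R (vu : M x * F x) := exists2 a : chain M, homogeneous 1 a &
  vu = (pmor M top_le (boundary a setT), pmor F top_le (boundary (gc a) setT)).
have Rlift : partial_lift (p x) (f x) R.
  split.
  - exists 0; first by move=> S _; rewrite dprod0.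
    by rewrite !linear0 !dprod0 !linear0.
  - move=> c _ _ _ _ [a ai [-> ->]] [b bi [-> ->]].
    exists (c *: a + b).
      by move=> S Si; rewrite dprodD dprodZ ai // bi // scaler0 addr0.
    by rewrite !linearP !dprodD !dprodZ !linearP.
  - move=> u [a ai [a0 ->]].
    have {}a0 : boundary a = 0.
      apply/ffunP=> T; rewrite dprod0; have [->|TT] := eqVneq T setT.
        by rewrite -(pmor_cancel top_le le_top (boundary a setT)) -a0 linear0.
      apply: (homogeneous_boundary ai); rewrite addn0.
      by apply: contraNneq TT => Tk; rewrite eqEcard subsetT cardsT card_ord Tk /=.
    have [b ba] := M1 a ai a0.
    suff -> : boundary (gc a) setT = 0 by rewrite linear0.
    rewrite -(dprod0 (fun S => ppull F X S) setT) -(boundary_sq (gc b)) !ffunE.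
    apply: eq_bigr => j _; rewrite -/(gc a) -/(gc b).
    by rewrite map_boundary ?setTD1_neq // ba ffunE.
  - move=> v u [a ai [-> ->]].
    rewrite !phom_natural; congr (pmor G _ _); rewrite !ffunE !linear_sum.
    apply: eq_bigr => j _; rewrite !linearZ /= !phom_natural ffunE g_lift //.
    exact/lower_cube_lt/setTD1_neq.
have [h [ph Rh]] := linear_lift (p_epi (x := x)) Rlift.
exists h; split=> // y yx ltyx v; apply: Rh.
have [j yj] := exists_lower_cover_ge ltyx.
have {}yj : (y <= X (setT :\ j))%O.
  by rewrite /= meet_cubeD1 // ltW // covered_lt // lower_coverP.
set s := koszul_sign K setT j.
(* The factor [s] is its own inverse and cancels the sign in the boundary. *)
have [a [a0 av]] := dprod_delta (V := fun S => ppull M X S) (s *: pmor M yj v).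
have bE (N : pmod K P) (b : chain N) : (forall T, T != setT :\ j -> b T = 0) ->
    pmor N top_le (boundary b setT) =
    s *: pmor N (le_trans (omorph_le X (le_setD1 setT j)) top_le) (b (setT :\ j)).
  move=> b0; rewrite ffunE (bigD1 j (in_setT j)) /= big1 ?addr0.
    rewrite linearZ /=; congr (_ *: _); exact/esym/pmor_comp.
  move=> l /andP[_ lj]; rewrite b0 ?linear0 ?scaler0 //.
  by apply: contraNneq lj => /setP/(_ l); rewrite !inE eqxx andbT; case: eqVneq.
exists a.
  move=> S Sk; apply: a0; apply: contraNneq Sk => ->.
  by rewrite addn1 -[X in _ == X]card_ord -cardsT (cardsD1 j setT) inE.
have gc0 T : T != setT :\ j -> gc a T = 0 by move=> Tj; rewrite ffunE a0 // linear0.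
rewrite !bE // /gc ffunE av !linearZ /= !linearZ /= !scalerA koszul_sign_sq !scale1r.
rewrite (g_nat yj) ?lower_cube_lt ?setTD1_neq //.
by congr (_, _); apply: pmor_comp.
Qed.

End Extension.

(** The lift is built by induction on the number of elements below [x]. The values
    at elements of equal rank do not constrain each other, so that they are chosen
    simultaneously. *)
Lemma projective_of_acyclic (M : pmod K P) :
  (forall x, acyclic (ppull M (lower_cube x)) 1) -> projective M.
Proof.
move=> M1 F G p f p_epi; pose rank (x : P) := #|[set w | (w <= x)%O]|.
have rank_lt x y : (x < y)%O -> (rank x < rank y)%N.
  move=> xy; apply: proper_card; apply/properP; split.
    by apply/subsetP=> w; rewrite !inE => /le_trans; apply; apply: ltW.
  by exists y; rewrite !inE ?lexx // (lt_geF xy).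
have [n n_max] : exists n, forall x, (rank x <= n)%N.
  by exists #|P| => x; apply: max_card.
suff /(_ n)[g [g_nat g_lift]] : forall m, exists g : forall y, {linear M y -> F y},
    (forall y z (h : (y <= z)%O), (rank z <= m)%N ->
      forall v, g z (pmor M h v) = pmor F h (g y v)) /\
    (forall y, (rank y <= m)%N -> forall v, p y (g y v) = f y v).
  by exists (PHom (fun y z h => g_nat y z h (n_max z))) => x v; apply: g_lift.
elim=> [|m [g [g_nat g_lift]]].
  have rank0 x : (rank x <= 0)%N = false.
    by apply/negbTE; rewrite -ltnNge; apply/card_gt0P; exists x; rewrite inE.
  by exists (fun y => \0 : {linear M y -> F y}); split=> [y z h|y]; rewrite rank0.
have g_below x : (rank x <= m.+1)%N -> forall z, (z < x)%O -> (rank z <= m)%N.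
  by move=> xm z /rank_lt zx; rewrite -ltnS (leq_trans zx).
have ext x : exists h : {linear M x -> F x}, (rank x <= m.+1)%N ->
    (forall v, p x (h v) = f x v) /\
    forall y (yx : (y <= x)%O), (y < x)%O ->
    forall v, h (pmor M yx v) = pmor F yx (g y v).
  have [xm|_] := boolP (rank x <= m.+1)%N; last by exists (g x).
  have [||h hP] := @extend_lift M F G p f p_epi x g _ _ (M1 x).
  - by move=> y z h zx; apply: g_nat; apply: g_below zx.
  - by move=> y yx; apply: g_lift; apply: g_below yx.
  by exists h.
pose g' x := if (rank x <= m)%N then g x else sval (cid (ext x)).
have g'P x : (rank x <= m.+1)%N -> (forall v, p x (g' x v) = f x v) /\
    forall y (yx : (y <= x)%O), (y < x)%O ->
    forall v, g' x (pmor M yx v) = pmor F yx (g y v).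
  rewrite /g'; case: ifP => [xm _|_]; last by case: cid.
  by split=> [v|y yx _ v]; [apply: g_lift|apply: g_nat].
exists g'; split=> [y z h zm v|y ym]; last exact: (g'P y ym).1.
have [yz|yz] := eqVneq y z.
  by subst z; rewrite !pmor_id.
have ltyz : (y < z)%O by rewrite lt_neqAle yz h.
by rewrite (g'P z zm).2 // /g' (g_below z zm y ltyz).
Qed.

Lemma pcover_projective (Q : pmod K P) : projective (pcover Q).
Proof.
apply: projective_of_acyclic => x; apply: pcover_acyclic.
exact: meet_cube_stable.
Qed.

Definition pzero_module : pmod K P.
Proof.
by exists (fun=> 'rV[K]_0 : lmodType K)
  (fun x y _ => idfun : {linear 'rV[K]_0 -> 'rV[K]_0}).
Defined.

Lemma pzero_module_eq0 : pzero pzero_module.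
Proof. by move=> x v; apply: thinmx0. Qed.

Definition phom_from_zero (F : pmod K P) : phom pzero_module F.
Proof.
by exists (fun x => \0 : {linear 'rV[K]_0 -> F x}) => x y h v; rewrite linear0.
Defined.

(** Covers have no higher homology, so passing to the kernel of the cover lowers
    by one the degree in which the homology is known to vanish. *)
Lemma proj_dim_of_acyclic (F : pmod K P) (m : nat) :
  (forall x, acyclic (ppull F (lower_cube x)) m.+1) -> proj_dim_le F m.
Proof.
elim: m F => [|m IH] F F_acyclic.
  pose Q i := if i is 0 then F else pzero_module.
  pose dif i : phom (Q i.+1) (Q i) := phom_from_zero (Q i).
  exists Q, dif, (pid F).
  split=> [[|i]|[|i] //|x v|x v|i x v].
  - exact: projective_of_acyclic.
  - move=> G H p f _; exists (phom_from_zero G) => x v.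
    by rewrite (pzero_module_eq0 v) !linear0.
  - by move=> _; apply: pzero_module_eq0.
  - by exists v.
  - by split=> [/= ->|[w <-]] //; exists 0.
  - rewrite (pzero_module_eq0 (x := x) v) linear0.
    by split=> // _; exists 0; rewrite linear0.
have [x|Q [dif [aug [Qproj Q0 aug_epi ex0 ex]]]] := IH (pker (pcover_proj F)).
  apply: acyclic_ker; first exact: pcover_proj_epi.
    exact: F_acyclic.
  by apply: pcover_acyclic; apply: meet_cube_stable.
pose Q' i := if i is j.+1 then Q j else pcover F.
pose dif' i : phom (Q' i.+1) (Q' i) :=
  if i is j.+1 then dif j else pcompose (pker_incl (pcover_proj F)) aug.
exists Q', dif', (pcover_proj F); split=> [[|i]|[|i] //|x v|x v|[|i] x v].
- exact: pcover_projective.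
- exact: Qproj.
- by rewrite ltnS; apply: Q0.
- exact: pcover_proj_epi.
- rewrite pker_incl_exact; split=> [[w <-]|[w <-]].
    by have [u <-] := aug_epi _ w; exists u.
  by exists (aug x w).
- rewrite -ex0; split=> [v0|av0]; last by rewrite /= av0.
  exact: (@pker_incl_inj _ _ _ _ _ (pcover_proj F) x _ 0 v0).
- exact: ex.
Qed.

End ProjectivityCriterion.

(** * Projective dimension and degree *)

Section Invariance.
Variables (K : fieldType) (d : Order.disp_t).

Lemma piso_sym (P : porderType d) (F G : pmod K P) : piso F G -> piso G F.
Proof. by move=> [f [g [fK gK]]]; exists g, f. Qed.

Lemma piso_trans (P : finPOrderType d) (F G H : pmod K P) :
  piso F G -> piso G H -> piso F H.
Proof.
move=> [f [g [fK gK]]] [f' [g' [f'K g'K]]].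
exists (pcompose f' f), (pcompose g g').
by split=> x v /=; [rewrite f'K fK|rewrite gK g'K].
Qed.

Lemma jointly_injective_iso k (X Y : cube K k) : piso X Y ->
  jointly_injective Y -> jointly_injective X.
Proof.
move=> [f [g [fK _]]] Yinj a a0; rewrite -(fK _ a) (Yinj (f _ a)) ?linear0 // => i.
by rewrite -phom_natural a0 linear0.
Qed.

Lemma glues_iso k (X Y : cube K k) : piso X Y -> glues Y -> glues X.
Proof.
move=> [f [g [fK gK]]] Yg b bE.
have [i j|a aE] := Yg (fun i => f _ (b i)); first by rewrite -!phom_natural bE.
by exists (g _ a) => i; rewrite -phom_natural aE fK.
Qed.

Variable P : finTBDistrLatticeType d.
Implicit Types F G : pmod K P.

Lemma ppull_iso F G k (X : {omorphism {set 'I_k} -> P}) : piso F G ->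
  piso (ppull F X) (ppull G X).
Proof.
move=> [f [g [fK gK]]]; exists (ppull_hom f X), (ppull_hom g X).
by split=> S v; [apply: fK|apply: gK].
Qed.

Lemma degree_iso F G k : piso F G -> degree G k -> degree F k.
Proof.
move=> FG Gk X Xb; have /cartesianP[Ginj Gglue] := Gk X Xb.
apply/cartesianP; have FGX := ppull_iso X FG.
by split; [apply: jointly_injective_iso FGX Ginj|apply: glues_iso FGX Gglue].
Qed.

Lemma cross_degree_iso F G k : piso F G -> cross_degree G k -> cross_degree F k.
Proof.
move=> FG Gk X Xb; apply/tfib_eq0P/(jointly_injective_iso (ppull_iso X FG)).
by apply/tfib_eq0P; apply: Gk.
Qed.

End Invariance.

Section ProjectiveDimension.
Variables (K : fieldType) (d : Order.disp_t) (P : finTBDistrLatticeType d).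
Variables (F : pmod K P) (m : nat).

Lemma bicartesian_meet_stable k (X : {omorphism {set 'I_k} -> P}) :
  strongly_bicartesian X -> meet_stable X.
Proof. by move=> Xb y S T yS yT; rewrite (Xb S T).2 lexI yS yT. Qed.

Lemma degree_of_proj_dim : proj_dim_le F m -> degree F m.+1 /\ cross_degree F m.
Proof.
move=> Fm; split=> X /bicartesian_meet_stable XI.
  apply/cartesianP; split; [apply/acyclic_top|apply/acyclic_glues];
    exact: proj_dim_acyclic Fm _.
by apply/tfib_eq0P/acyclic_top; apply: proj_dim_acyclic Fm _.
Qed.

Lemma proj_dim_of_degree : embeds_in_orders P m.+2 ->
  degree F m.+1 -> cross_degree F m -> proj_dim_le F m.
Proof.
move=> Pm Fd Fc; apply: proj_dim_of_acyclic => x.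
have := lower_covers_bound x Pm; have := @lower_cube_bicartesian _ P x.
move: (lower_cube x); move: #|lower_covers x| => k X Xb.
rewrite leq_eqVlt ltnS leq_eqVlt => /or3P[/eqP km|/eqP km|km].
- by subst k; apply/acyclic_glues; have /cartesianP[] := Fd X Xb.
- by subst k; apply/acyclic_top/tfib_eq0P; apply: Fc.
- exact: acyclic_gt.
Qed.

End ProjectiveDimension.

(** * Degree and truncation *)

Section TruncationElements.
Variables (K : fieldType) (d : Order.disp_t) (P : finTBDistrLatticeType d).
Variables (k : nat) (G : pmod K P).
Local Open Scope ring_scope.

Definition trunc_val x (s : trunc k G x) v (p : above k x v) : G v :=
  val s (exist _ v p).

Lemma trunc_ext x (s t : trunc k G x) :
  (forall v (p : above k x v), trunc_val s p = trunc_val t p) -> s = t.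
Proof. by move=> st; apply/val_inj/ffunP=> -[v p]; apply: st. Qed.

Lemma trunc_val0 x v (p : above k x v) : trunc_val 0 p = 0.
Proof. by rewrite /trunc_val /= dprod0. Qed.

Lemma trunc_val_pmor x y (h : (x <= y)%O) (s : trunc k G x) v
    (p : above k y v) (q : above k x v) :
  trunc_val (pmor (trunc k G) h s) p = trunc_val s q.
Proof. by rewrite /trunc_val /= ffunE; apply: (family_irrelevance (val s)). Qed.

Lemma trunc_val_compatible x (s : trunc k G x) u v (p : above k x u)
    (q : above k x v) (h : (u <= v)%O) :
  pmor G h (trunc_val s p) = trunc_val s q.
Proof. by have /asboolP sc := valP s; apply: (sc (exist _ u p) (exist _ v q)). Qed.

Lemma exists_trunc x (s : forall v, above k x v -> G v) :
  (forall u v (p : above k x u) (q : above k x v) (h : (u <= v)%O),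
     pmor G h (s u p) = s v q) ->
  exists t : trunc k G x, forall v (p : above k x v), trunc_val t p = s v p.
Proof.
move=> sc; pose t : dprod (fun v : {v : P | above k x v} => G (val v)) :=
  [ffun v => s (val v) (valP v)].
have tc : t \in compatible (F := G) (D := above k x).
  by apply/asboolP=> u v h; rewrite !ffunE; apply: sc.
exists (exist _ t tc) => v p; rewrite /trunc_val /= ffunE /=.
by have -> : valP (exist (fun v => above k x v) v p) = p by apply: bool_irrelevance.
Qed.

End TruncationElements.

Section TruncationDegree.
Variables (K : fieldType) (d : Order.disp_t) (P : finTBDistrLatticeType d).
Implicit Types F G : pmod K P.
Local Open Scope ring_scope.

(** The elements of small meet-dimension above the initial vertex are covered by
    the sets of those above the atoms, and two of these sets intersect in the set
    for the corresponding pair; compatible families glue along such a cover. *)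
Lemma degree_trunc k G : degree (trunc k G) k.
Proof.
move=> X Xb; apply/cartesianP; split=> [s s0|b bE].
  apply: trunc_ext => v p; rewrite trunc_val0.
  have /andP[vk Xv] := p; have [i iv] := bicartesian_atom_le Xb vk Xv.
  have q : above k (X [set i]) v by rewrite /above vk.
  have := congr1 (fun t => trunc_val t q) (s0 i).
  by rewrite /= trunc_val0 => <-; apply/esym/trunc_val_pmor.
have atom v (p : above k (X set0) v) : {i | above k (X [set i]) v}.
  apply: cid; have /andP[vk Xv] := p; have [i iv] := bicartesian_atom_le Xb vk Xv.
  by exists i; rewrite /above vk.
have b_indep i j v (p : above k (X [set i]) v) (q : above k (X [set j]) v) :
    trunc_val (b i) p = trunc_val (b j) q.
  have r : above k (X [set i; j]) v.
    have /andP[vk iv] := p; have /andP[_ jv] := q.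
    by rewrite /above vk (Xb _ _).1 leUx iv jv.
  have := congr1 (fun t => trunc_val t r) (bE i j).
  by rewrite /= (trunc_val_pmor _ _ _ p) (trunc_val_pmor _ _ _ q).
have [u v p q h|s sE] := @exists_trunc K d P k G (X set0)
    (fun v p => trunc_val (b _) (svalP (atom v p))).
  have r : above k (X [set sval (atom u p)]) v.
    have /andP[_ Xu] := svalP (atom u p); have /andP[vk _] := q.
    by rewrite /above vk (le_trans Xu h).
  by rewrite (trunc_val_compatible _ _ r) (b_indep _ _ _ r (svalP (atom v q))).
exists s => i; apply: trunc_ext => v p.
have q : above k (X set0) v.
  have /andP[vk iv] := p; rewrite /above vk (le_trans _ iv) //.
  by apply: omorph_le; apply: le0x.
by rewrite /= (trunc_val_pmor _ _ _ q) sE; apply: b_indep.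
Qed.

(** An element of the truncation that dies along the atoms of an [m.+1]-cube dies
    at every [w] above the cube: its value at [w] lies in the image of [F w] in
    the coarser truncation, so it is detected by elements of meet-dimension at most
    [m], and these lie above atoms. *)
Lemma cross_degree_trunc_Gamma m F : cross_degree (trunc m.+1 (Gamma m F)) m.
Proof.
move=> X Xb; apply/tfib_eq0P => s s0.
apply: trunc_ext => w p; rewrite trunc_val0; apply/val_inj/trunc_ext => v q.
rewrite [RHS]trunc_val0; have /andP[_ Xw] := p; have /andP[vm wv] := q.
have [i iv] := bicartesian_atom_le Xb vm (le_trans Xw wv).
have vm1 : (mdim v <= m.+1)%N by apply: leq_trans vm _.
have r : above m.+1 (X [set i]) v by rewrite /above vm1.
have p' : above m.+1 (X set0) v by rewrite /above vm1 (le_trans Xw wv).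
have q' : above m v v by rewrite /above vm lexx.
have sv0 : trunc_val s p' = 0.
  have e : pmor (trunc m.+1 (Gamma m F)) (omorph_le X (le0x [set i])) s = 0 := s0 i.
  rewrite -(trunc_val_pmor (omorph_le X (le0x [set i])) s r p') e.
  exact: trunc_val0.
have := trunc_val_compatible s p p' wv; rewrite sv0.
move=> /(congr1 val)/(congr1 (fun t => trunc_val t q')) /=.
by rewrite trunc_val0 => <-; apply/esym/trunc_val_pmor.
Qed.

Lemma upward_induction (Q : P -> Prop) :
  (forall x, (forall y, (x < y)%O -> Q y) -> Q x) -> forall x, Q x.
Proof.
move=> QP x; have [n] := ubnP #|[set w | (x < w)%O]|.
elim: n x => // n IH x xn; apply: QP => y xy; apply: IH.
rewrite ltnS in xn; apply: leq_trans xn; apply: proper_card.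
apply/properP; split; last by exists y; rewrite !inE ?ltxx.
by apply/subsetP=> w; rewrite !inE; apply: lt_trans.
Qed.

(** An element [x] of meet-dimension greater than [m] has at least [m.+1] upper
    covers. By induction [a] dies at each of them, so it lies in the total fiber of
    the cube spanned by [m.+1] of them. *)
Lemma trunc_unit_inj F m : cross_degree F m ->
  forall x (a : F x),
  (forall v (p : above m x v), pmor F (above_ge p) a = 0) -> a = 0.
Proof.
move=> Fc; apply: upward_induction => x IH a a0.
have [xm|xm] := leqP (mdim x) m.
  have p : above m x x by rewrite /above xm lexx.
  by rewrite -(a0 x p) pmor_id.
have [c [c_inj xc _]] := exists_upper_covers (leq_trans xm (mdim_le_upper_covers x)).
pose X : {omorphism {set 'I_m.+1} -> P} := join_cube x c.
have Xb : strongly_bicartesian X by apply: upper_cube_bicartesian.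
have /tfib_eq0P Xinj := Fc X Xb.
have h : (x <= X set0)%O by rewrite /= join_cube0.
have h' : (X set0 <= x)%O by rewrite /= join_cube0.
rewrite -(pmor_cancel (F := F) h h' a) (Xinj (pmor F h a)) ?linear0 // => i.
have xXi : (x < X [set i])%O.
  by rewrite /= join_cube1 ?ltW ?covered_lt.
apply: IH => // v p; have /andP[vm iv] := p.
have q : above m x v by rewrite /above vm (le_trans (ltW xXi) iv).
rewrite -(a0 v q) (pmor_comp h (le_trans (omorph_le X (le0x [set i])) iv)).
exact/esym/pmor_comp.
Qed.

(** The elements outside the truncation have exactly [m.+2] upper covers, and all
    that is strictly above such an element lies above one of them. The values at
    the upper covers, known by induction, glue because the cube is cartesian. *)
Lemma trunc_unit_bijective F m : embeds_in_orders P m.+2 -> degree F m.+1 ->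
  forall x, bijective (trunc_unit m.+1 F x).
Proof.
move=> Pm Fd; apply: upward_induction => x IH.
have {}IH y xy := (plim_cone_bijP F (@above_ge _ P m.+1 y)).1 (IH y xy).
apply/(plim_cone_bijP F (@above_ge _ P m.+1 x)).
have [xm|xm] := leqP (mdim x) m.+1.
  have p : above m.+1 x x by rewrite /above xm lexx.
  split=> [a a0|s sc]; first by rewrite -(a0 x p) pmor_id.
  by exists (s x p) => v q; apply: sc.
have xc_card : m.+2 = #|upper_covers x|.
  apply/eqP; rewrite eqn_leq upper_covers_bound // andbT.
  exact: leq_trans xm (mdim_le_upper_covers x).
have [c [c_inj xc /(_ xc_card) xc_ge]] := exists_upper_covers (eq_leq xc_card).
pose X : {omorphism {set 'I_m.+2} -> P} := join_cube x c.
have Xb : strongly_bicartesian X by apply: upper_cube_bicartesian.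
have /cartesianP[Xinj Xglue] := Fd X Xb.
have h : (x <= X set0)%O by rewrite /= join_cube0.
have h' : (X set0 <= x)%O by rewrite /= join_cube0.
have Xi i : X [set i] = c i by rewrite /= join_cube1 ?ltW ?covered_lt.
have xXi i : (x < X [set i])%O by rewrite Xi covered_lt.
have above_X y v : (x <= y)%O -> above m.+1 y v -> above m.+1 x v.
  by move=> xy /andP[vm yv]; rewrite /above vm (le_trans xy yv).
split=> [a a0|s sc].
  rewrite -(pmor_cancel (F := F) h h' a) (Xinj (pmor F h a)) ?linear0 // => i.
  apply: (IH _ (xXi i)).1 => v p; have q := above_X _ _ (ltW (xXi i)) p.
  rewrite -(a0 v q).
  rewrite (pmor_comp h (le_trans (omorph_le X (le0x [set i])) (above_ge p))).
  exact/esym/pmor_comp.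
have /(_ _)/cid b i : exists b : F (X [set i]), forall v (p : above m.+1 (X [set i]) v),
    pmor F (above_ge p) b = s v (above_X _ _ (ltW (xXi i)) p).
  by apply: (IH _ (xXi i)).2 => u v p q g; apply: sc.
have [i j|a aE] := Xglue (fun i => sval (b i)).
  have xXij : (x < X [set i; j])%O.
    by apply: lt_le_trans (xXi i) _; apply: omorph_le; apply: le_set2l.
  apply/eqP; rewrite -subr_eq0; apply/eqP; apply: (IH _ xXij).1 => v p.
  have /andP[vm Xv] := p.
  have pi : above m.+1 (X [set i]) v.
    by rewrite /above vm (le_trans _ Xv) //; apply: omorph_le; apply: le_set2l.
  have pj : above m.+1 (X [set j]) v.
    by rewrite /above vm (le_trans _ Xv) //; apply: omorph_le; apply: le_set2r.
  rewrite linearB /= -!(pmor_comp _ _ (above_ge pi)) -!(pmor_comp _ _ (above_ge pj)).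
  rewrite (svalP (b i)) (svalP (b j)).
  by apply/eqP; rewrite subr_eq0; apply/eqP; congr s; apply: bool_irrelevance.
exists (pmor F h' a) => v p; have /andP[vm xv] := p.
have [|i iv] := xc_ge v.
  rewrite lt_neqAle xv andbT; apply: contraTneq vm => <-.
  by rewrite -ltnNge.
have q : above m.+1 (X [set i]) v by rewrite /above vm Xi.
have <- : pmor F (above_ge q) (sval (b i)) = s v p.
  by rewrite (svalP (b i)); congr s; apply: bool_irrelevance.
by rewrite -aE; apply: pmor_square.
Qed.

(** Cross-degree [m] identifies [F] with its image [Gamma m F], which therefore
    inherits the degree of [F]. *)
Lemma iso_trunc_Gamma F m : embeds_in_orders P m.+2 -> degree F m.+1 ->
  cross_degree F m -> piso F (trunc m.+1 (Gamma m F)).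
Proof.
move=> Pm Fd Fc.
have imP x a : trunc_unit m F x a \in lin_im (trunc_unit m F x).
  by apply/asboolP; exists a.
have e_nat x y (h : (x <= y)%O) a :
    (corestr (imP y) : {linear _ -> Gamma m F y}) (pmor F h a) =
    pmor (Gamma m F) h (corestr (imP x) a).
  by apply/val_inj; apply: (phom_natural (trunc_unit m F)).
have FG : piso F (Gamma m F).
  apply: (@piso_of_bijective K d P F (Gamma m F) (PHom e_nat)) => x.
  apply/linear_bijP; split=> [a /(congr1 val) a0|w].
    apply: (trunc_unit_inj Fc) => v p.
    have := congr1 (fun t => trunc_val t p) a0.
    by rewrite /= trunc_val0 /trunc_val /= ffunE => <-; apply: pmor_irr.
  by have /asboolP[a aw] := valP w; exists a; apply/val_inj.
have Gd : degree (Gamma m F) m.+1 by apply: degree_iso (piso_sym FG) Fd.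
exact: (piso_trans FG (piso_of_bijective (trunc_unit_bijective Pm Gd))).
Qed.

End TruncationDegree.

Theorem theorem5p16 (K : fieldType) (d : Order.disp_t)
    (P : finTBDistrLatticeType d) (n : nat) (F : pmod K P) :
  (2 <= n)%N -> order_dim P n -> finitely_generated F ->
  [<-> proj_dim_le F (n - 2);
       degree F (n - 1) /\ cross_degree F (n - 2);
       piso F (trunc (n - 1) (Gamma (n - 2) F))].
Proof.
case: n => [|[|m]] // _ [Pm _] _.
have -> : (m.+2 - 2 = m)%N by rewrite !subSS subn0.
have -> : (m.+2 - 1 = m.+1)%N by rewrite subSS subn0.
tfae=> [|[Fd Fc]|FT].
- exact: degree_of_proj_dim.
- exact: iso_trunc_Gamma.
- apply: proj_dim_of_degree => //.
    exact: degree_iso FT (@degree_trunc K d P m.+1 (Gamma m F)).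
  exact: cross_degree_iso FT (@cross_degree_trunc_Gamma K d P m F).
Qed.
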